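(* Let $G\subset U(V)$ be a finite complex reflection group and $k=(k_{C,i})$ a tuple of complex parameters. The map $d(k)$ is a differential on $K^\bullet$, i.e. $d(k)^2=0$. In addition, the complex $(K^\bullet(+),d(k))$ is acyclic (i.e. its cohomology is $0$) if for all $\tau\in\hat G$ one has $-c_\tau(k)\notin\mathbb{N}$.
   Context: $V$ is a finite dimensional complex Hilbert space. A complex reflection is an element $g\in U(V)$ of finite order such that $\operatorname{Ker}(g-\operatorname{Id})$ is a hyperplane; a finite complex reflection group is a finite subgroup $G\subset U(V)$ generated by complex reflections. For a hyperplane $H$, $G_H\subset G$ is the (cyclic) pointwise stabilizer; $H$ is a reflection hyperplane if $G_H\ne\{\operatorname{Id}\}$, and then $e_H=|G_H|$. $\mathcal{A}$ is the set of reflection hyperplanes, $\mathcal{C}$ the set of $G$-orbits in $\mathcal{A}$; $e_C=e_H$ for $H\in C$. $\chi_H=\det|_{G_H}$. Choose $\alpha_H\in V^*$ with kernel $H$. $P$ is the ring of complex polynomials on $V$, $P_m$ its homogeneous part of degree $m$, with $G$-action $p^g(x)=p(g^{-1}x)$. Parameters $k=(k_{C,i})$, $k_{C,i}\in\mathbb{C}$, $C\in\mathcal{C}$, $1\le i\le e_C-1$; $k_{H,i}=k_{C,i}$ if $H\in C$. Put $\epsilon_{H,i}=\frac1{e_H}\sum_{g\in G_H}\chi_H^i(g)g$ and $a_H(k)=\sum_{i=1}^{e_H-1}e_Hk_{H,i}\epsilon_{H,i}\in\mathbb{C}[G_H]$. $K^\bullet=P\otimes\bigwedge^\bullet V^*$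 is the algebra of polynomial differential forms, $K^l_m=P_m\otimes\bigwedge^lV^*$, and $K^\bullet(+)=\bigoplus_{l+m>0}K^l_m$ (the complement of $K(0)=K^0_0=\mathbb{C}$). With $\omega_H=\alpha_H^{-1}d\alpha_H$, define for $p\in P$ and $\omega\in\bigwedge^\bullet V^*$ $$d(k)(p\otimes\omega)=\Big(dp+\sum_{H\in\mathcal{A}}a_H(k)(p)\,\omega_H\Big)\wedge\omega,$$ extended linearly; this maps $K^l_m$ to $K^{l+1}_{m-1}$. $\hat G$ is the set of irreducible complex representations of $G$. The element $z(k)=\sum_{H\in\mathcal{A}}a_H(k)$ is central in $\mathbb{C}[G]$, and $c_\tau(k)$ is the scalar by which $z(k)$ acts on $\tau\in\hat G$. $\mathbb{N}=\{1,2,3,\dots\}$. *)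

(* Defs.v *)
From HB Require Import structures.
From mathcomp Require Import all_boot all_order all_algebra all_fingroup.
From mathcomp Require Import all_character.
From mathcomp Require Import finmap complex reals mpoly.
From mathcomp Require classical_sets.

Set Implicit Arguments.
Unset Strict Implicit.
Unset Printing Implicit Defensive.

Import GRing.Theory.

Local Open Scope ring_scope.

(* The Hilbert space V is C^n, as column vectors, with its standard Hermitian
   product.  A finite subgroup of U(V) is given as a finite group G together
   with a faithful representation rG by unitary matrices; x \in G acts on V by
   v |-> rG x *m v, a left action since rG (x * y) = rG x *m rG y. *)

Section ReflectionGroup.

Variables (R : realType) (n : nat) (gT : finGroupType) (G : {group gT}).
Variable rG : mx_representation R[i] G n.

Local Notation C := R[i].
Local Notation V := 'cV[R[i]]_n.

Definition gact (x : gT) : 'End(V) := linfun (mulmx (rG x)).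

Definition hyperplane (H : {vspace V}) : bool := (\dim H).+1 == n.

(* fixedSpace (gact x) is Ker(x - Id); the order of x is finite as gT is. *)
Definition complex_reflection (x : gT) : bool :=
  hyperplane (fixedSpace (gact x)).

Definition complex_reflection_group : Prop :=
  [/\ mx_faithful rG,
      forall x, x \in G -> rG x \is unitarymx
    & <<[set x in G | complex_reflection x]>>%g = G :> {set gT}].

Definition hstab (H : {vspace V}) : {set gT} :=
  [set x in G | (H <= fixedSpace (gact x))%VS].

Definition hord (H : {vspace V}) : nat := #|hstab H|.

Definition reflection_hyperplane (H : {vspace V}) : bool :=
  hyperplane H && (hstab H != 1%g).

(* When rG is faithful this is the set of all reflection hyperplanes: see
   in_hyperplanes. *)
Definition hyperplanes : {fset {vspace V}} :=
  [fset H in [seq fixedSpace (gact x) | x <- enum G] |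
    reflection_hyperplane H]%fset.

Lemma in_hyperplanes (H : {vspace V}) :
  mx_faithful rG -> (H \in hyperplanes) = reflection_hyperplane H.
Proof.
move=> rGf; rewrite !inE /= andb_idl // => /andP[/eqP dimH ntH].
have hstab1 : 1%g \in hstab H.
  rewrite inE group1; apply/fixedSpacesP=> v _.
  by rewrite lfunE /= repr_mx1 mul1mx.
have [x Hx ntx] : exists2 x, x \in hstab H & x != 1%g.
  apply/exists_inP; apply: contraR ntH; rewrite negb_exists_in => /forall_inP e.
  rewrite eqEsubset sub1set hstab1 andbT.
  by apply/subsetP=> x /e; rewrite negbK inE.
move: Hx; rewrite inE => /andP[Gx sHx].
apply/mapP; exists x; first by rewrite mem_enum.
have dimV : \dim {:V} = n by rewrite dimvf dim_matrix mulr1.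
apply/eqP; rewrite eqEdim sHx -ltnS dimH -[X in (_ < X)%N]dimV ltnNge.
apply: contra ntx => dimx.
have fixE : fixedSpace (gact x) = fullv by apply/eqP; rewrite eqEdim subvf.
apply/eqP/(mx_faithful_inj rGf); rewrite ?group1 // repr_mx1.
apply/matrixP=> i j.
have /fixedSpaceP : delta_mx j 0 \in fixedSpace (gact x) by rewrite fixE memvf.
by rewrite lfunE /= -colE => /colP/(_ i); rewrite !mxE eqxx andbT.
Qed.

Definition horbit (H : {vspace V}) : {fset {vspace V}} :=
  [fset (gact x @: H)%VS | x in enum G]%fset.

(* The group algebra C[G] is represented by coefficient functions gT -> C,
   of which only the values on G matter. *)
Definition galg_repr (m : nat) (tau : mx_representation C G m)
    (a : {ffun gT -> C^o}) : 'M[C]_m :=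
  \sum_(x in G) a x *: tau x.

Definition poly_act (x : gT) (p : {mpoly C[n]}) : {mpoly C[n]} :=
  p \mPo [tuple \sum_(j < n) rG (x^-1)%g i j *: 'X_j | i < n].

Definition galg_poly (a : {ffun gT -> C^o}) (p : {mpoly C[n]}) :
    {mpoly C[n]} :=
  \sum_(x in G) a x *: poly_act x p.

Definition heps (H : {vspace V}) (i : nat) : {ffun gT -> C^o} :=
  [ffun x => if x \in hstab H then \det (rG x) ^+ i / (hord H)%:R else 0].

(* The parameter k_{C,i} is k C i, for an orbit C of reflection hyperplanes
   and 1 <= i <= e_C - 1; the other values of k are never used. *)
Variable k : {fset {vspace V}} -> nat -> C.

Definition ha (H : {vspace V}) : {ffun gT -> C^o} :=
  \sum_(1 <= i < hord H) ((hord H)%:R * k (horbit H) i) *: heps H i.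

Definition gz : {ffun gT -> C^o} := \sum_(H <- hyperplanes) ha H.

End ReflectionGroup.

Section Forms.

Variables (R : realType) (n : nat).
Local Notation C := R[i].
Local Notation V := 'cV[R[i]]_n.

(* K = P (x) /\ V^*: w I is the coefficient of
   dx_I = dx_{i_1} /\ ... /\ dx_{i_l}, for I = {i_1 < ... < i_l}. *)
Definition pform : Type := {ffun {set 'I_n} -> {mpoly C[n]}}.
HB.instance Definition _ := GRing.Zmodule.on pform.

(* p (x) dx_I *)
Definition form_tensor (p : {mpoly C[n]}) (I : {set 'I_n}) : pform :=
  [ffun J => if J == I then p else 0].

Definition form_scale (p : {mpoly C[n]}) (w : pform) : pform :=
  [ffun I => p * w I].

(* dx_I /\ dx_J is 0 if I meets J, and otherwise dx_{I :|: J} up to the sign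
   (-1)^(winv I J). *)
Definition winv (I J : {set 'I_n}) : nat :=
  #|[set ij : 'I_n * 'I_n | [&& ij.1 \in I, ij.2 \in J & (ij.2 < ij.1)%N]]|.

Definition wedge (w1 w2 : pform) : pform :=
  [ffun K : {set 'I_n} => \sum_(I : {set 'I_n} | I \subset K)
    (-1) ^+ winv I (K :\: I) * (w1 I * w2 (K :\: I))].

Definition pdiff (p : {mpoly C[n]}) : pform :=
  \sum_(i < n) form_tensor p^`M(i) [set i].

Definition linear_poly (f : 'Hom(V, C^o)) : {mpoly C[n]} :=
  \sum_(i < n) f (delta_mx i 0) *: 'X_i.

(* The quotient p / q when q divides p (unique if q != 0), else 0. *)
Definition poly_quo (p q : {mpoly C[n]}) : {mpoly C[n]} :=
  classical_sets.xget 0 (fun r => r * q = p).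

(* The component of w in K^l_m = P_m (x) /\^l V^*. *)
Definition form_part (l m : nat) (w : pform) : pform :=
  [ffun I : {set 'I_n} => if #|I| == l then pihomog mdeg m (w I) else 0].

Definition in_Kplus (l : nat) (w : pform) : Prop :=
  forall l' m : nat, form_part l' m w != 0 -> l' = l /\ (0 < l' + m)%N.

(* The cochain complex (K^0(+) -> K^1(+) -> ...) has zero cohomology. *)
Definition Kplus_acyclic (d : pform -> pform) : Prop :=
  (forall w, in_Kplus 0 w -> d w = 0 -> w = 0) /\
  (forall l w, in_Kplus l.+1 w -> d w = 0 -> exists2 u, in_Kplus l u & d u = w).

End Forms.

Section Differential.

Variables (R : realType) (n : nat) (gT : finGroupType) (G : {group gT}).
Variable rG : mx_representation R[i] G n.
Local Notation C := R[i].
Local Notation V := 'cV[R[i]]_n.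
Variable k : {fset {vspace V}} -> nat -> C.
Variable alpha : {vspace V} -> 'Hom(V, C^o).

(* a_H(k)(p) omega_H = (a_H(k)(p) / alpha_H) d alpha_H; the quotient is exact
   because eps_{H,i}(p) vanishes on H for 1 <= i < e_H. *)
Definition dunkl_term (H : {vspace V}) (p : {mpoly C[n]}) : pform R n :=
  form_scale (poly_quo (galg_poly rG (ha rG k H) p) (linear_poly (alpha H)))
             (pdiff (linear_poly (alpha H))).

Definition dunkl_d (w : pform R n) : pform R n :=
  \sum_(I : {set 'I_n})
    wedge (pdiff (w I) + \sum_(H <- hyperplanes rG) dunkl_term H (w I))
          (form_tensor 1 I).

End Differential.

(* Main.v *)
(** The Dunkl operators T_i = d/dx_i + sum_H alpha_H(e_i) alpha_H^{-1} a_H are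
    determined by T_i 1 = 0 and by
      [T_i, x_l] = delta_{il} + sum_{x in G} z(x) (x^{-1} - 1)_{li} x,
    where z = sum_H a_H is central and supported on elements x with x - 1 of
    rank at most one.  An induction along p |-> x_l p gives the equivariance
    of T; then, by the Jacobi identity, [T_i, T_j] commutes with every x_l, and
    as it kills 1 it vanishes, which is d^2 = 0.  With the Koszul differential b
    (contraction with the Euler field), d b + b d acts on K^l_m as l + m + z,
    for the diagonal action of G.  No -c_tau is a positive integer, so l + m + z
    is invertible in C[G] (a kernel in the regular representation would contain
    an irreducible submodule), and its inverse commutes with d: this is a
    contracting homotopy. *)

Require Import Defs.
From mathcomp Require Import all_boot all_order all_algebra all_fingroup.
From mathcomp Require Import all_character.
From mathcomp Require Import finmap complex reals mpoly.
From mathcomp Require Import ring.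
From mathcomp Require classical_sets.
From HB Require Import structures.

Set Implicit Arguments.
Unset Strict Implicit.
Unset Printing Implicit Defensive.

Import GRing.Theory.

Local Open Scope ring_scope.

(** * Exterior algebra *)

Section Exterior.

Variables (F : numFieldType) (n : nat) (P : lmodType F).
Local Notation W := {ffun {set 'I_n} -> P}.
Implicit Types (i j : 'I_n) (K I : {set 'I_n}) (w : W).

(** Rank one makes both computations close. If x = 1 + u a and x^{-1} = 1 + s a with the same row a,
    then (x^{-1} - 1)_{li} (x - 1)_{mj} = s_l a_i u_m a_j is symmetric in i and j, which is what the
    Jacobi argument needs. On forms such an x acts as w + a /\ (contraction of w by s), since
    further terms would contain a twice; this is the correction that [T_i, x_j] produces in d b + b
    d, and it turns z acting on coefficients into z acting diagonally. The action on forms is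
    characterised by its values on generators: the rank-one formula provides it for reflections,
    composition for all of G. Division by alpha_H is confined to the construction of T; afterwards
    only the brackets and T_i 1 = 0 are used. The inverse of l + m + z depends on l + m, so the
    homotopy is taken on each homogeneous part separately, and it is obtained as a coefficient
    function on G that acts on any G-module, whatever its dimension. *)

Definition nbelow i K : nat := #|[set j in K | (j < i)%N]|.

(* A form is encoded by its coefficients [w K] on the [dx_K]; [ext i] is the
   exterior product by [dx_i], and [contr j] the contraction by [d/dx_j]. *)
Definition ext i w : W :=
  [ffun K : {set 'I_n} => if i \in K then (-1) ^+ nbelow i K *: w (K :\ i) else 0].

Definition contr j w : W :=
  [ffun K : {set 'I_n} => if j \in K then 0 else (-1) ^+ nbelow j K *: w (j |: K)].

Definition coefwise (f : P -> P) w : W := [ffun K => f (w K)].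

Definition form1 (p : P) : W := [ffun K : {set 'I_n} => if K == set0 then p else 0].

Definition proj l w : W := [ffun K : {set 'I_n} => if #|K| == l then w K else 0].

Fact ext_is_linear i : linear (ext i).
Proof.
move=> a u v; apply/ffunP=> K; rewrite !ffunE.
case: ifP => _; last by rewrite scaler0 addr0.
by rewrite scalerDr !scalerA mulrC.
Qed.
HB.instance Definition _ i := GRing.isLinear.Build F W W _ (ext i) (ext_is_linear i).

Fact contr_is_linear i : linear (contr i).
Proof.
move=> a u v; apply/ffunP=> K; rewrite !ffunE.
case: ifP => _; first by rewrite scaler0 addr0.
by rewrite scalerDr !scalerA mulrC.
Qed.
HB.instance Definition _ i := GRing.isLinear.Build F W W _ (contr i) (contr_is_linear i).

Fact coefwise_is_linear (f : {linear P -> P}) : linear (coefwise f).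
Proof. by move=> a u v; apply/ffunP=> K; rewrite !ffunE linearP. Qed.
HB.instance Definition _ (f : {linear P -> P}) :=
  GRing.isLinear.Build F W W _ (coefwise f) (coefwise_is_linear f).

Fact proj_is_linear l : linear (proj l).
Proof.
by move=> a u v; apply/ffunP=> K; rewrite !ffunE; case: ifP; rewrite // scaler0 addr0.
Qed.
HB.instance Definition _ l := GRing.isLinear.Build F W W _ (proj l) (proj_is_linear l).

Lemma nbelowD1 i j K :
  nbelow i K = (((j \in K) && (j < i)) + nbelow i (K :\ j))%N.
Proof.
rewrite /nbelow (cardsD1 j) !inE; congr (_ + _)%N.
by apply: eq_card => x; rewrite !inE andbA.
Qed.

Lemma nbelowU1 i j K : j \notin K -> nbelow i (j |: K) = ((j < i) + nbelow i K)%N.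
Proof. by move=> jK; rewrite (nbelowD1 i j) setU11 setU1K. Qed.

Lemma extC i j w : ext i (ext j w) = - ext j (ext i w).
Proof.
apply/ffunP=> K; rewrite !ffunE !inE; have [<-|ij] := eqVneq i j.
  by rewrite /= !scaler0 !if_same oppr0.
rewrite /=; case: ifP => /= iK; case: ifP => /= jK; rewrite ?scaler0 ?oppr0 //.
rewrite !scalerA -scaleNr !setDDl [in X in w (K :\: X)]setUC; congr (_ *: _).
rewrite (nbelowD1 i j) jK (nbelowD1 j i K) iK /=.
have [lij|lji|eij] := ltngtP i j; last by case/eqP: ij; apply: val_inj.
  by rewrite !add0n add1n exprS mulN1r mulNr opprK mulrC.
by rewrite !add0n add1n exprS mulN1r mulNr mulrC.
Qed.

(** The canonical anticommutation relation. For i = j, the coefficient of w at K survives in exactly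
    one of the two composites, according to whether i belongs to K. *)
Lemma contr_ext i j w :
  contr j (ext i w) = (if i == j then w else 0) - ext i (contr j w).
Proof.
apply/ffunP=> K; rewrite !ffunE !inE; have [<-|ij] := eqVneq i j.
  rewrite /=; case: ifP => iK; last first.
    rewrite setU1K ?iK // nbelowU1 ?iK // ltnn /= scalerA -exprD addnn -mul2n exprM.
    by rewrite sqrrN expr1n expr1n scale1r subr0.
  rewrite setD1K // (nbelowD1 i i) iK ltnn /= add0n scalerA -exprD addnn -mul2n exprM.
  by rewrite sqrrN expr1n expr1n scale1r subrr.
rewrite ffunE /= sub0r.
case: ifP => jK; first by rewrite scaler0 if_same oppr0.
case: ifP => iK; last by rewrite scaler0 oppr0.
have -> : (j |: K) :\ i = j |: K :\ i.
  by apply/setP=> x; rewrite !inE; case: (eqVneq x i) => // ->; rewrite (negPf ij).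
rewrite !scalerA -scaleNr; congr (_ *: _).
rewrite nbelowU1 ?jK // (nbelowD1 j i) iK /=.
have [lij|lji|eij] := ltngtP i j; last by case/eqP: ij; apply: val_inj.
  by rewrite !add0n add1n exprS mulN1r mulNr mulrC.
by rewrite !add0n add1n exprS mulN1r mulrN mulrC.
Qed.

Lemma coefwise_ext (f : {linear P -> P}) i w :
  coefwise f (ext i w) = ext i (coefwise f w).
Proof.
by apply/ffunP=> K; rewrite !ffunE; case: ifP => _; rewrite ?linear0 ?linearZ.
Qed.

Lemma coefwise_contr (f : {linear P -> P}) i w :
  coefwise f (contr i w) = contr i (coefwise f w).
Proof.
by apply/ffunP=> K; rewrite !ffunE; case: ifP => _; rewrite ?linear0 ?linearZ.
Qed.

Lemma proj_ext l i w : proj l.+1 (ext i w) = ext i (proj l w).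
Proof.
apply/ffunP=> K; rewrite !ffunE; case: (boolP (i \in K)) => iK; last by rewrite if_same.
by rewrite (cardsD1 i K) iK eqSS; case: ifP; rewrite // scaler0.
Qed.

(** Each [ext i \o contr i] is the projector onto the coefficients at the sets K containing i, so
    the sum multiplies w K by the cardinal of K: this is the Euler identity on the exterior side. *)
Lemma sum_ext_contr l w : proj l w = w -> \sum_i ext i (contr i w) = l%:R *: w.
Proof.
move=> lw; apply/ffunP=> K; rewrite sum_ffunE ffunE.
have [lK|lK] := eqVneq #|K| l; last first.
  have w0 : w K = 0 by rewrite -lw ffunE (negPf lK).
  rewrite w0 scaler0 big1 // => i _; rewrite !ffunE; case: ifP => // iK.
  by rewrite setD11 setD1K // w0 !scaler0.
rewrite -lK -sumr_const scaler_suml [RHS]big_mkcond; apply: eq_bigr => i _.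
rewrite !ffunE; case: ifP => // iK; rewrite setD11 setD1K // scalerA -exprD.
rewrite (nbelowD1 i i K) ltnn andbF add0n addnn -mul2n exprM.
by rewrite sqrrN !expr1n.
Qed.

(* the exterior-algebra extension of the linear map [dx_i |-> \sum_j A i j dx_j] *)
Definition exterior_map (A : 'M[F]_n) (L : {linear W -> W}) : Prop :=
  [/\ forall (f : {linear P -> P}) w, L (coefwise f w) = coefwise f (L w),
      forall i w, L (ext i w) = \sum_j A i j *: ext j (L w)
    & forall p, L (form1 p) = form1 p].

(** Monomial forms are built from constants by the [ext i], so an induction on the size of I
    determines the map. Applied to products of matrices, this yields multiplicativity of extensions
    chosen arbitrarily. *)
Lemma exterior_map_unique A L1 L2 :
  exterior_map A L1 -> exterior_map A L2 -> L1 =1 L2.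
Proof.
move=> [_ L1e L1o] [_ L2e L2o].
pose tensor p I : W := [ffun J => if J == I then p else 0].
have tensorE p I : L1 (tensor p I) = L2 (tensor p I).
  move: {2}#|I| (erefl #|I|) => m; elim: m => [|m IHm] in p I *.
    by move/eqP; rewrite cards_eq0 => /eqP ->; rewrite [L1 _]L1o [L2 _]L2o.
  move=> Im; have /card_gt0P[i iI] : (0 < #|I|)%N by rewrite Im.
  (* The sign put on p cancels the one that [ext i] introduces. *)
  have -> : tensor p I = ext i (tensor ((-1) ^+ nbelow i I *: p) (I :\ i)).
    apply/ffunP=> K; rewrite !ffunE; case: (eqVneq K I) => [->|KI].
      rewrite iI eqxx scalerA -exprD addnn -mul2n exprM.
      by rewrite sqrrN !expr1n scale1r.
    case: ifP => // iK; case: eqP => [e|]; last by rewrite scaler0.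
    by case/eqP: KI; rewrite -(setD1K iK) e setD1K.
  rewrite L1e L2e; apply: eq_bigr => j _; rewrite IHm //.
  by move: Im; rewrite (cardsD1 i) iI => -[].
move=> w; have -> : w = \sum_I tensor (w I) I.
  apply/ffunP=> K; rewrite sum_ffunE (bigD1 K) //= ffunE eqxx big1 ?addr0 // => I.
  by rewrite ffunE eq_sym => /negPf->.
rewrite !linear_sum.
by apply: eq_bigr => I _; apply: tensorE.
Qed.

(** Row i of the matrix lists the image of dx_i, hence the reversed order of the product. *)
Lemma exterior_map_comp A B L M :
  exterior_map A L -> exterior_map B M -> exterior_map (B *m A) (L \o M).
Proof.
move=> [Lf Le Lo] [Mf Me Mo]; split=> [f w|i w|p] /=.
- by rewrite Mf Lf.
- rewrite Me linear_sum /=.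
  under [LHS]eq_bigr => j _ do rewrite linearZ /= Le scaler_sumr.
  rewrite exchange_big; apply: eq_bigr => k _ /=; rewrite mxE scaler_suml.
  by apply: eq_bigr => j _; rewrite scalerA.
by rewrite Mo Lo.
Qed.

Lemma exterior_map_id : exterior_map 1%:M idfun.
Proof.
split=> // i w; rewrite /= (bigD1 i) //= mxE eqxx scale1r big1 ?addr0 // => j.
by rewrite mxE eq_sym => /negPf->; rewrite scale0r.
Qed.

(** This is w + a /\ (contraction of w by s), the closed form of the exterior extension of dx_i |->
    dx_i + s_i a. *)
Definition rank1_map (s : 'cV[F]_n) (a : 'rV[F]_n) w : W :=
  w + \sum_i \sum_j (a 0 i * s j 0) *: ext i (contr j w).

Fact rank1_map_is_linear s a : linear (rank1_map s a).
Proof.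
move=> c u v; rewrite /rank1_map scalerDr addrACA; congr (_ + _).
rewrite scaler_sumr -big_split /=; apply: eq_bigr => i _.
rewrite scaler_sumr -big_split /=; apply: eq_bigr => j _.
by rewrite !linearP.
Qed.
HB.instance Definition _ s a :=
  GRing.isLinear.Build F W W _ (rank1_map s a) (rank1_map_is_linear s a).

Lemma exterior_map_rank1 s a : exterior_map (1%:M + s *m a) (rank1_map s a).
Proof.
split=> [f w|i w|p]; rewrite /= /rank1_map.
- rewrite linearD linear_sum /=; congr (_ + _).
  apply: eq_bigr => i _; rewrite linear_sum /=; apply: eq_bigr => j _.
  by rewrite linearZ /= coefwise_ext coefwise_contr.
- pose D v : W := \sum_i \sum_j (a 0 i * s j 0) *: ext i (contr j v).
  pose ea v : W := \sum_i a 0 i *: ext i v.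
  pose cs v : W := \sum_j s j 0 *: contr j v.
  have eaB u v : ea (u - v) = ea u - ea v.
    by rewrite /ea -sumrB; apply: eq_bigr => k _; rewrite linearB scalerBr.
  have eaZ c v : ea (c *: v) = c *: ea v.
    by rewrite /ea scaler_sumr; apply: eq_bigr => k _; rewrite linearZ /= !scalerA mulrC.
  have ea_sum (f : 'I_n -> W) : ea (\sum_k f k) = \sum_k ea (f k).
    rewrite /ea [RHS]exchange_big /=; apply: eq_bigr => k _.
    by rewrite linear_sum scaler_sumr.
  have eaC v k : ext k (ea v) = - ea (ext k v).
    rewrite linear_sum -sumrN; apply: eq_bigr => k' _.
    by rewrite linearZ /= extC scalerN.
  (* Each [ext k] anticommutes with [ea], so the square of [ea] is its own opposite, hence zero in
     characteristic zero. *)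
  have ea_sq v : ea (ea v) = 0.
    have : ea (ea v) = - ea (ea v).
      rewrite {1}/ea; under eq_bigr => k _ do rewrite eaC scalerN -eaZ.
      by rewrite sumrN -ea_sum.
    move/eqP; rewrite -addr_eq0 -mulr2n -scaler_nat scaler_eq0 Num.Theory.pnatr_eq0 /=.
    by move/eqP.
  have DE v : D v = ea (cs v).
    apply: eq_bigr => k _; rewrite linear_sum scaler_sumr.
    by apply: eq_bigr => j _; rewrite linearZ /= scalerA.
  have csE v : cs (ext i v) = s i 0 *: v - ext i (cs v).
    rewrite /cs; under eq_bigr => j _ do rewrite contr_ext scalerBr.
    rewrite sumrB; congr (_ - _); last first.
      by rewrite linear_sum; apply: eq_bigr => j _; rewrite linearZ.
    rewrite (bigD1 i) //= eqxx big1 ?addr0 // => j.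
    by rewrite eq_sym => /negPf->; rewrite scaler0.
  (* Since D = [ea] after [cs], the square-zero property gives [ea (D w) = 0]; moving [ext i] out
     past [cs] and then [ea] changes the sign twice. *)
  transitivity (ext i (w + D w) + s i 0 *: ea (w + D w)).
    have -> : ea (w + D w) = ea w.
      by rewrite DE -[X in w + X]opprK eaB -(scaleN1r (ea (cs w))) eaZ ea_sq scaler0 subr0.
    rewrite -/(D _) !DE csE eaB eaZ linearD /= eaC -addrA; congr (_ + _).
    by rewrite addrC.
  rewrite -/(D _).
  rewrite [RHS](eq_bigr (fun j => (i == j)%:R *: ext j (w + D w) +
    s i 0 *: (a 0 j *: ext j (w + D w)))); last first.
    by move=> j _; rewrite !mxE big_ord1 scalerDl scalerA.
  rewrite big_split /= -scaler_sumr; congr (_ + _).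
  rewrite (bigD1 i) //= eqxx scale1r big1 ?addr0 // => j.
  by rewrite eq_sym => /negPf->; rewrite scale0r.
have c0 j : contr j (form1 p) = 0.
  apply/ffunP=> K; rewrite !ffunE; case: ifP => // jK.
  case: eqP => [e|]; last by rewrite scaler0.
  by move: (setU11 j K); rewrite e inE.
rewrite big1 ?addr0 // => i _; rewrite big1 // => j _.
by rewrite c0 linear0 scaler0.
Qed.

End Exterior.

(** * Inverting central elements of the group algebra *)

Section GroupAlgebra.

Variables (F : fieldType) (gT : finGroupType) (G : {group gT}).
Local Notation reg := (regular_repr F G).

Lemma central_shift_unitmx (z : gT -> F) (c : F) :
    {in G &, forall x y, z (x ^ y)%g = z x} ->
    (forall m (tau : mx_representation F G m), mx_irreducible tau ->
       \sum_(x in G) z x *: tau x <> (- c)%:M) ->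
  c%:M + \sum_(x in G) z x *: reg x \in unitmx.
Proof.
move=> zJ irrz; set A := _ + _.
have cA : centgmx reg A.
  apply/centgmxP=> y Gy; rewrite mulmxDl mulmxDr scalar_mxC; congr (_ + _).
  rewrite mulmx_suml mulmx_sumr [RHS](reindex_acts 'J _ Gy) ?astabsJ ?normG //=.
  apply: eq_bigr => x Gx; rewrite -scalemxAl -scalemxAr zJ //; congr (_ *: _).
  by rewrite -!repr_mxM ?groupJ // conjgC.
rewrite -row_free_unit -kermx_eq0; apply/idPn => kA.
suff: false by [].
apply: (mxsimple_exists (kermx_centg_module cA) kA) => -[U simU UA].
have modU := mxsimple_module simU.
case: (irrz _ (submod_repr modU)); first by apply/(submod_mx_irr modU).
apply: (@val_submod_inj _ _ U); rewrite -scalemx1 linear_sum /=.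
have /sub_kermxP : (val_submod (1%:M : 'M_(\rank U)) <= kermx A)%MS.
  by apply: submx_trans UA; rewrite val_submodP.
rewrite mulmxDr mul_mx_scalar => /eqP; rewrite addrC addr_eq0 => /eqP e.
rewrite linearZ /= scaleNr -e mulmx_sumr; apply: eq_bigr => x Gx.
by rewrite !linearZ /= -[submod_mx _ _]mul1mx val_submodJ.
Qed.

(** A row vector of the regular representation is an element of the group algebra. [Phi] lets it act
    on W, and turns right multiplication by A into a prior application of c + z. An inverse found in
    the regular representation thus inverts c + z on every G-module at once. *)
Lemma group_algebra_inverse (z : gT -> F) (c : F) :
    {in G &, forall x y, z (x ^ y)%g = z x} ->
    (forall m (tau : mx_representation F G m), mx_irreducible tau ->
       \sum_(x in G) z x *: tau x <> (- c)%:M) ->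
  exists b : gT -> F, forall (W : lmodType F) (M : gT -> {linear W -> W}),
    M 1%g =1 id -> {in G &, forall x y w, M (x * y)%g w = M x (M y w)} ->
  forall w, \sum_(x in G) b x *: M x (c *: w + \sum_(y in G) z y *: M y w) = w.
Proof.
move=> zJ irrz; have Au := central_shift_unitmx zJ irrz.
set A := _ + _ in Au.
(* The image of the unit of the group algebra under the inverse of A, that is, the inverse of c + z
   itself. *)
pose v : 'rV_#|G| := delta_mx 0 (gring_index G 1) *m invmx A.
exists (fun x => v 0 (gring_index G x)) => W M M1 MM w.
pose Phi (u : 'rV_#|G|) w' := \sum_i u 0 i *: M (enum_val i) w'.
have PhiD u1 u2 w' : Phi (u1 + u2) w' = Phi u1 w' + Phi u2 w'.
  by rewrite -big_split /=; apply: eq_bigr => i _; rewrite mxE scalerDl.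
have PhiZ a u w' : Phi (a *: u) w' = a *: Phi u w'.
  by rewrite scaler_sumr; apply: eq_bigr => i _; rewrite mxE scalerA.
have Phi_reg u y w' : y \in G -> Phi (u *m reg y) w' = Phi u (M y w').
  move=> Gy; pose f (i : 'I_#|G|) := gring_index G (enum_val i * y)%g.
  have finj : injective f.
    move=> i j /(congr1 enum_val); rewrite !gring_indexK ?groupM ?enum_valP //.
    by move/mulIg/enum_val_inj.
  rewrite [LHS](reindex_inj finj); apply: eq_bigr => i _.
  rewrite gring_indexK ?groupM ?enum_valP // MM ?enum_valP //; congr (_ *: _).
  rewrite mxE (bigD1 i) //= big1 ?addr0 => [|j ji].
    by rewrite !mxE !eqxx mulr1.
  by rewrite !mxE -/(f j) eq_sym (inj_eq finj) (negPf ji) mulr0.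
have PhiA u w' :
    Phi (u *m A) w' = Phi u (c *: w' + \sum_(y in G) z y *: M y w').
  rewrite mulmxDr PhiD mul_mx_scalar mulmx_sumr.
  have -> : Phi (\sum_(x in G) u *m (z x *: reg x)) w' =
            \sum_(x in G) z x *: Phi u (M x w').
    rewrite [LHS](big_morph (Phi ^~ w') (id1 := 0) (op1 := +%R)).
    - by apply: eq_bigr => x Gx; rewrite -scalemxAr PhiZ Phi_reg.
    - by move=> *; rewrite PhiD.
    by rewrite -(scale0r 0) PhiZ scale0r.
  rewrite PhiZ /Phi; under [X in _ + X]eq_bigr => x _ do rewrite scaler_sumr.
  rewrite scaler_sumr exchange_big -big_split; apply: eq_bigr => i _ /=.
  rewrite linearD linear_sum scalerDr; congr (_ + _).
    by rewrite [M _ (_ *: _)]linearZ !scalerA mulrC.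
  rewrite scaler_sumr; apply: eq_bigr => x _.
  by rewrite [M _ (_ *: _)]linearZ !scalerA mulrC.
transitivity (Phi v (c *: w + \sum_(y in G) z y *: M y w)).
  by rewrite big_enum_val; apply: eq_bigr => i _; rewrite gring_valK.
rewrite -PhiA mulmxKV // /Phi (bigD1 (gring_index G 1)) //= big1 => [|i i1].
  by rewrite addr0 mxE !eqxx scale1r gring_indexK // M1.
by rewrite mxE (negPf i1) scale0r.
Qed.

End GroupAlgebra.

(** * Dunkl operators *)

(** The induction suited to operators known only on constants and through their brackets with the
    variables. *)
Lemma mpoly_mulX_ind (n : nat) (F : comNzRingType) (Q : {mpoly F[n]} -> Prop) :
    (forall c, Q c%:MP) -> (forall p q, Q p -> Q q -> Q (p + q)) ->
    (forall i p, Q p -> Q ('X_i * p)) ->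
  forall p, Q p.
Proof.
move=> QC QD QX; have QM m c : Q (c *: 'X_[m]).
  have [k] := ubnP (mdeg m); elim: k m => // k IHk m.
  have [->|m0] := eqVneq m 0%MM; first by rewrite mpolyX0 alg_mpolyC.
  have [i mi] : exists i, m i != 0.
    apply/existsP; apply: contraR m0 => /existsPn m0.
    by apply/eqP/mnmP=> i; rewrite mnm0E; apply/eqP; have := m0 i; rewrite negbK.
  have -> : m = (U_(i) + (m - U_(i)))%MM.
    rewrite addmC submK //; apply/mnm_lepP=> j; rewrite mnm1E.
    by case: eqP => // <-; rewrite lt0n.
  rewrite mdegD mdeg1 add1n ltnS => mk; rewrite mpolyXD scalerAr.
  by apply: QX; apply: IHk.
move=> p; elim/mpolyind: p => [|c m p _ _ Qp]; first by rewrite -mpolyC0.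
exact: QD.
Qed.

(* Locked, as otherwise unification unfolds the arithmetic of {mpoly F[n]}. *)
HB.lock Definition lin_subst (n : nat) (F : comNzRingType) (A : 'M[F]_n)
    (p : {mpoly F[n]}) : {mpoly F[n]} :=
  p \mPo [tuple \sum_(j < n) A i j *: 'X_j | i < n].

(** * Linear substitutions and homogeneous components *)

Section PolyAct.

Variables (F : numFieldType) (n : nat).
Local Notation P := {mpoly F[n]}.
Implicit Types (A B : 'M[F]_n) (p : P).

Fact lin_subst_is_linear A : linear (lin_subst A).
Proof. by move=> c p q; rewrite lin_subst.unlock linearP. Qed.
HB.instance Definition _ A :=
  GRing.isLinear.Build F P P _ (lin_subst A) (lin_subst_is_linear A).

Lemma lin_substX A i : lin_subst A 'X_i = \sum_j A i j *: 'X_j.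
Proof. by rewrite lin_subst.unlock comp_mpolyXU -tnth_nth tnth_mktuple. Qed.

Lemma lin_substC A c : lin_subst A c%:MP = c%:MP.
Proof. by rewrite lin_subst.unlock comp_mpolyC. Qed.

Lemma lin_substM A p q : lin_subst A (p * q) = lin_subst A p * lin_subst A q.
Proof. by rewrite lin_subst.unlock rmorphM. Qed.

Lemma lin_subst_mulX A i p :
  lin_subst A ('X_i * p) = \sum_j A i j *: ('X_j * lin_subst A p).
Proof.
rewrite lin_substM lin_substX mulr_suml.
by apply: eq_bigr => j _; rewrite scalerAl.
Qed.

Lemma lin_subst_id p : lin_subst 1%:M p = p.
Proof.
elim/mpoly_mulX_ind: p => [c|p q IHp IHq|i p IHp]; first exact: lin_substC.
  by rewrite linearD /= IHp IHq.
rewrite lin_subst_mulX IHp (bigD1 i) //= mxE eqxx scale1r big1 ?addr0 // => j ji.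
by rewrite mxE eq_sym (negPf ji) scale0r.
Qed.

Lemma lin_subst_comp A B p : lin_subst (B *m A) p = lin_subst A (lin_subst B p).
Proof.
elim/mpoly_mulX_ind: p => [c|p q IHp IHq|i p IHp].
- by rewrite !lin_substC.
- by rewrite !linearD /= IHp IHq.
rewrite !lin_subst_mulX linear_sum IHp.
under [RHS]eq_bigr => j _ do rewrite linearZ /= lin_subst_mulX scaler_sumr.
rewrite exchange_big; apply: eq_bigr => j _ /=.
rewrite mxE scaler_suml.
by apply: eq_bigr => k _; rewrite scalerA.
Qed.

Lemma pihomog_mulX m i p : pihomog mdeg m.+1 ('X_i * p) = 'X_i * pihomog mdeg m p.
Proof.
elim/mpolyind: p => [|c a p _ _ IHp]; first by rewrite !(mulr0, pihomog0).
rewrite mulrDr !pihomogD IHp mulrDr; congr (_ + _).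
rewrite -scalerAr !linearZ /= -mpolyXD !pihomogX /= mdegD mdeg1 add1n eqSS.
by rewrite -scalerAr; case: ifP; rewrite ?mulr0 // mpolyXD.
Qed.

Lemma pihomog0_mulX i p : pihomog mdeg 0 ('X_i * p) = 0.
Proof.
elim/mpolyind: p => [|c a p _ _ IHp]; first by rewrite !(mulr0, pihomog0).
rewrite mulrDr !pihomogD IHp addr0.
by rewrite -scalerAr !linearZ /= -mpolyXD !pihomogX /= mdegD mdeg1 scaler0.
Qed.

Lemma pihomog_mpolyC m c :
  pihomog mdeg m (c%:MP : P) = if m == 0%N then c%:MP else 0.
Proof.
rewrite -[c%:MP]alg_mpolyC linearZ /= -mpolyX0 pihomogX /= mdeg0 eq_sym.
by case: eqP; rewrite ?scaler0.
Qed.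

Lemma pihomog_lin_subst m A p :
  pihomog mdeg m (lin_subst A p) = lin_subst A (pihomog mdeg m p).
Proof.
elim/mpoly_mulX_ind: p => [c|p q IHp IHq|i p IHp] in m *.
- by rewrite lin_substC pihomog_mpolyC; case: eqP; rewrite ?lin_substC ?linear0.
- by rewrite !linearD /= IHp IHq.
rewrite lin_subst_mulX linear_sum /=; case: m => [|m].
  rewrite pihomog0_mulX linear0 big1 // => j _.
  by rewrite linearZ /= pihomog0_mulX scaler0.
rewrite pihomog_mulX lin_subst_mulX; apply: eq_bigr => j _.
by rewrite linearZ /= pihomog_mulX IHp.
Qed.

End PolyAct.

Section DunklOperators.

Variables (F : numFieldType) (n : nat) (gT : finGroupType) (G : {group gT}).
Variable rG : mx_representation F G n.
Local Notation P := {mpoly F[n]}.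
Local Notation act x := (lin_subst (rG (x^-1)%g)).
Implicit Types (x y : gT) (p : P) (i j l : 'I_n).

Lemma lin_subst_repr1 p : act 1%g p = p.
Proof. by rewrite invg1 repr_mx1 lin_subst_id. Qed.

Lemma lin_subst_reprM x y p : x \in G -> y \in G -> act (x * y)%g p = act x (act y p).
Proof. by move=> Gx Gy; rewrite invMg repr_mxM ?groupV // lin_subst_comp. Qed.

Variables (z : gT -> F) (T : 'I_n -> {linear P -> P}).
Hypothesis zJ : {in G &, forall x y, z (x ^ y)%g = z x}.
Hypothesis z_sum : \sum_(x in G) z x = 0.
Hypothesis z_rank1 : forall x, x \in G -> z x != 0 ->
  exists (u s : 'cV[F]_n) (a : 'rV[F]_n),
    rG x = 1%:M + u *m a /\ rG (x^-1)%g = 1%:M + s *m a.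
Hypothesis T_1 : forall i, T i 1 = 0.
Hypothesis T_mulX : forall i l p, T i ('X_l * p) = 'X_l * T i p +
  ((i == l)%:R *: p + \sum_(x in G) (z x * (rG (x^-1)%g - 1%:M) l i) *: act x p).

Lemma T_C i c : T i c%:MP = 0.
Proof. by rewrite -alg_mpolyC linearZ /= T_1 scaler0. Qed.

Lemma T_equivariant y i p : y \in G ->
  act y (T i p) = \sum_j rG y j i *: T j (act y p).
Proof.
move=> Gy; elim/mpoly_mulX_ind: p => [c|p q IHp IHq|l p IHp] in i *.
- rewrite T_C linear0 big1 // => j _; by rewrite lin_substC T_C scaler0.
- rewrite !linearD /= IHp IHq -big_split; apply: eq_bigr => j _ /=.
  by rewrite !linearD.
pose Yi := rG (y^-1)%g; pose Y := rG y.
have YK : Yi *m Y = 1%:M by rewrite -repr_mxM ?groupV // mulVg repr_mx1.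
rewrite T_mulX !linearD /= lin_substM IHp lin_substX.
transitivity (\sum_j Y j i *: \sum_m Yi l m *: T j ('X_m * act y p)); last first.
  apply: eq_bigr => j _; rewrite lin_subst_mulX; congr (_ *: _).
  by rewrite [RHS]linear_sum; apply: eq_bigr => m _; rewrite linearZ.
under [RHS]eq_bigr => j _.
  under eq_bigr => m _ do rewrite T_mulX scalerDr scalerDr.
  rewrite !big_split /= !scalerDr.
  over.
rewrite !big_split /=; congr (_ + (_ + _)).
- rewrite mulr_sumr; apply: eq_bigr => j _.
  rewrite -scalerAr mulr_suml; congr (_ *: _).
  by apply: eq_bigr => m _; rewrite scalerAl.
- have : (Yi *m Y) l i = (1%:M : 'M_n) l i by rewrite YK.
  rewrite !mxE linearZ /= eq_sym => <-; rewrite scaler_suml; apply: eq_bigr => j _.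
  rewrite (bigD1 j) //= big1 => [|m mj]; last first.
    by rewrite eq_sym (negPf mj) scale0r scaler0.
  by rewrite eqxx addr0 scale1r scalerA mulrC.
(* The group sum is reindexed by conjugation, which preserves z; then y (x ^ y) = x y moves y to the
   right, and x ^ y - 1 is the conjugate of x - 1 by the matrix of y. *)
rewrite linear_sum /= [LHS](reindex_acts 'J _ Gy) ?astabsJ ?normG //=.
under [RHS]eq_bigr => j _.
  under eq_bigr => m _ do rewrite scaler_sumr.
  rewrite exchange_big scaler_sumr /=.
  over.
rewrite exchange_big; apply: eq_bigr => x Gx /=.
rewrite linearZ /= -lin_subst_reprM ?groupJ // -conjgC lin_subst_reprM // zJ //.
have -> : rG (x ^ y)^-1%g - 1%:M = Yi *m (rG x^-1%g - 1%:M) *m Y.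
  rewrite -conjVg /conjg mulmxBr mulmx1 mulmxBl YK.
  by rewrite !repr_mxM ?groupM ?groupV // mulmxA.
rewrite mxE mulr_sumr scaler_suml; apply: eq_bigr => j _.
rewrite mxE mulr_suml mulr_sumr scaler_suml scaler_sumr; apply: eq_bigr => m _.
by rewrite !scalerA; congr (_ *: _); ring.
Qed.

Lemma T_comm i j p : T i (T j p) = T j (T i p).
Proof.
apply/eqP; rewrite -subr_eq0; apply/eqP.
elim/mpoly_mulX_ind: p => [c|p q IHp IHq|l p IHp].
- by rewrite !T_C !linear0 addr0.
- by rewrite !linearD /= addrACA IHp IHq addr0.
(* [B i] is the bracket of [T i] with ['X_l]. The Jacobi identity reduces the induction step to
   [BTC]: [B_i, T_j] is symmetric in i and j. *)
pose B i p := (i == l)%:R *: p +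
  \sum_(x in G) (z x * (rG (x^-1)%g - 1%:M) l i) *: act x p.
have TT i' j' : T i' (T j' ('X_l * p)) =
    'X_l * T i' (T j' p) + B i' (T j' p) + T i' (B j' p).
  by rewrite T_mulX linearD /= T_mulX.
have BT i' j' : B i' (T j' p) - T j' (B i' p) =
    \sum_(x in G) z x *: \sum_m ((rG (x^-1)%g - 1%:M) l i' * (rG x - 1%:M) m j')
      *: T m (act x p).
  rewrite /B linearD linearZ /= opprD addrACA subrr add0r linear_sum -sumrB /=.
  apply: eq_bigr => x Gx; rewrite linearZ /= -scalerBr -scalerA; congr (_ *: _).
  rewrite T_equivariant //.
  have -> : T j' (act x p) = \sum_m (1%:M : 'M_n) m j' *: T m (act x p).
    rewrite (bigD1 j') //= mxE eqxx scale1r big1 ?addr0 // => m mj.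
    by rewrite mxE (negPf mj) scale0r.
  rewrite -sumrB scaler_sumr; apply: eq_bigr => m _.
  by rewrite -scalerBl scalerA [(rG x - _) _ _]mxE [(- _ : 'M_n) _ _]mxE.
have BTC : B i (T j p) - T j (B i p) = B j (T i p) - T i (B j p).
  rewrite !BT; apply: eq_bigr => x Gx.
  have [->|zx] := eqVneq (z x) 0; first by rewrite !scale0r.
  (* Both coefficients become s_l u_m a_i a_j, because x - 1 and x^{-1} - 1 share the row a. *)
  have [u [s [a [-> ->]]]] := z_rank1 Gx zx.
  rewrite ![_ + _ - _]addrC !addKr; congr (_ *: _); apply: eq_bigr => m _.
  by congr (_ *: _); rewrite !mxE !big_ord1 mulrACA [a 0 i * _]mulrC mulrACA.
rewrite !TT.
transitivity ('X_l * (T i (T j p) - T j (T i p)) +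
   ((B i (T j p) - T j (B i p)) - (B j (T i p) - T i (B j p)))).
  by ring.
by rewrite IHp mulr0 add0r BTC subrr.
Qed.

Lemma T_pihomog0 i p : T i (pihomog mdeg 0 p) = 0.
Proof.
elim/mpoly_mulX_ind: p => [c|p q IHp IHq|l p IHp].
- by rewrite pihomog_mpolyC T_C.
- by rewrite !linearD /= IHp IHq addr0.
by rewrite pihomog0_mulX linear0.
Qed.

(** The bracket of [T i] with ['X_l] is a combination of linear substitutions and so preserves
    degree ([BE]); hence [T i] lowers degree by one by induction, starting from the constants it
    kills. *)
Lemma T_pihomog m i p : T i (pihomog mdeg m.+1 p) = pihomog mdeg m (T i p).
Proof.
elim/mpoly_mulX_ind: p => [c|p q IHp IHq|l p IHp] in m *.
- by rewrite T_C pihomog_mpolyC /= !linear0.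
- by rewrite !linearD /= IHp IHq.
have BE q : pihomog mdeg m (T i ('X_l * q) - 'X_l * T i q) =
   T i ('X_l * pihomog mdeg m q) - 'X_l * T i (pihomog mdeg m q).
  rewrite !T_mulX ![_ * _ + _ - _]addrC !addKr linearD linearZ linear_sum /=.
  congr (_ + _); apply: eq_bigr => x _.
  by rewrite linearZ /= pihomog_lin_subst.
have := BE p; rewrite linearB /= pihomog_mulX => /eqP; rewrite subr_eq => /eqP ->.
case: m {BE} IHp => [|m] IHp; first by rewrite pihomog0_mulX T_pihomog0 mulr0 subr0 addr0.
by rewrite pihomog_mulX -IHp subrK.
Qed.

(** The Euler identity deformed by z. On constants it holds because the coefficients of z sum to
    zero. *)
Lemma sum_X_T m p : p = pihomog mdeg m p ->
  \sum_i 'X_i * T i p = m%:R *: p + \sum_(x in G) z x *: act x p.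
Proof.
(* With p replaced by its own component of degree m, the claim makes sense for every polynomial and
   can be proved along sums and products by variables. *)
move=> ->; elim/mpoly_mulX_ind: p => [c|p q IHp IHq|l p IHp] in m *.
- rewrite pihomog_mpolyC; case: m => [|m]; last first.
    rewrite scaler0 add0r !big1 // => x _; rewrite ?linear0 ?mulr0 //.
  rewrite scale0r add0r big1 => [|i _]; last by rewrite T_C mulr0.
  under eq_bigr => x _ do rewrite lin_substC.
  by rewrite -scaler_suml z_sum scale0r.
- rewrite linearD /= scalerDr; under eq_bigr => i _ do rewrite linearD mulrDr.
  rewrite big_split /= IHp IHq addrACA -big_split; congr (_ + _).
  by apply: eq_bigr => x _; rewrite linearD scalerDr.
case: m => [|m].
  rewrite pihomog0_mulX scaler0 add0r !big1 // => x _; rewrite ?linear0 ?mulr0 ?scaler0 //.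
rewrite pihomog_mulX; set q := pihomog mdeg m p in IHp *.
under eq_bigr => i _ do rewrite T_mulX mulrDr mulrDr mulrCA mulr_sumr.
rewrite !big_split /= -mulr_sumr (IHp m) mulrDr.
have -> : \sum_(i < n) 'X_i * ((i == l)%:R *: q) = 'X_l * q.
  rewrite (bigD1 l) //= eqxx scale1r big1 ?addr0 // => i il.
  by rewrite (negPf il) scale0r mulr0.
rewrite exchange_big /= -[m.+1]addn1 natrD scalerDl scale1r -scalerAr -!addrA.
congr (_ + _); rewrite addrCA; congr (_ + _).
rewrite mulr_sumr -big_split; apply: eq_bigr => x _ /=.
rewrite lin_substM lin_substX.
(* Summing (x^{-1})_{li} x_i over i gives the image of x_l under x, so the bracket term exchanges
   x_l (x . q) for x . (x_l q). *)
rewrite (eq_bigr (fun i => z x *: ((rG x^-1%g l i *: 'X_i * act x q) -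
    (if i == l then 'X_l * act x q else 0)))) => [|i _].
  rewrite -scaler_sumr sumrB -mulr_suml -big_mkcond big_pred1_eq scalerBr.
  by rewrite -scalerAr addrC subrK.
rewrite -scalerAr -scalerA; congr (_ *: _); rewrite 2!mxE [in X in _ + X]mxE eq_sym.
rewrite scalerBl -scalerAl; congr (_ - _).
by case: eqP => [->|]; rewrite ?scale1r ?scale0r.
Qed.

End DunklOperators.

(** * Division by linear forms and construction of the Dunkl operators *)

Definition linear_form (n : nat) (F : comNzRingType) (a : 'rV[F]_n) : {mpoly F[n]} :=
  \sum_i a 0 i *: 'X_i.

Lemma linear_form_neq0 (n : nat) (F : comNzRingType) (a : 'rV[F]_n) :
  a != 0 -> linear_form a != 0.
Proof.
apply: contraNneq => a0; apply/eqP/rowP=> i.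
have := congr1 (mcoeff U_(i)) a0; rewrite mcoeff0 linear_sum /= mxE => <-.
rewrite (bigD1 i) //= mcoeffZ mcoeffX eqxx mulr1 big1 ?addr0 // => j ji.
rewrite mcoeffZ mcoeffX; case: eqP => [/mnmP/(_ i)|]; last by rewrite mulr0.
by rewrite !mnm1E eqxx (negPf ji).
Qed.

Lemma mderiv_mulX (n : nat) (F : comNzRingType) (i l : 'I_n) (p : {mpoly F[n]}) :
  ('X_l * p)^`M(i) = 'X_l * p^`M(i) + (i == l)%:R *: p.
Proof.
rewrite mderivM addrC mderivX mnm1E eq_sym; congr (_ + _).
case: eqP => [->|_]; last by rewrite !scale0r mul0r.
have -> : (U_(l) - U_(l))%MM = 0%MM by apply/mnmP=> j; rewrite mnmBE subnn mnm0E.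
by rewrite mpolyX0 !scale1r mul1r.
Qed.

Section QuotientOperators.

Variables (F : numFieldType) (n : nat) (gT : finGroupType) (G : {group gT}).
Variable rG : mx_representation F G n.
Local Notation P := {mpoly F[n]}.
Local Notation act x := (lin_subst (rG (x^-1)%g)).

(** Modulo the form a, the substitution fixes every variable, hence every polynomial. *)
Lemma linear_form_dvd_act (x : gT) (s : 'cV_n) (a : 'rV_n) (p : P) :
    rG (x^-1)%g = 1%:M + s *m a ->
  exists q, act x p - p = q * linear_form a.
Proof.
move=> xE; elim/mpoly_mulX_ind: p => [c|p q [p' IHp] [q' IHq]|i p [p' IHp]].
- by exists 0; rewrite lin_substC subrr mul0r.
- by exists (p' + q'); rewrite linearD opprD addrACA IHp IHq mulrDl.
have Xi : act x 'X_i = 'X_i + s i 0 *: linear_form a.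
  rewrite lin_substX xE /linear_form scaler_sumr.
  rewrite (eq_bigr (fun j => (i == j)%:R *: 'X_j + s i 0 *: (a 0 j *: 'X_j))) => [|j _].
    rewrite big_split /=; congr (_ + _); rewrite (bigD1 i) //= eqxx scale1r.
    by rewrite big1 ?addr0 // => j ji; rewrite eq_sym (negPf ji) scale0r.
  by rewrite !mxE big_ord1 scalerDl scalerA.
exists ('X_i * p' + s i 0 *: act x p); rewrite lin_substM Xi mulrDl mulrDl.
rewrite -mulrA -IHp mulrBr -!scalerAl [linear_form a * _]mulrC; ring.
Qed.

(** As the coefficients sum to zero, [act x p] may be replaced by [act x p - p], which is divisible
    term by term. *)
Lemma linear_form_dvd_sum (a : 'rV_n) (c : gT -> F) (p : P) :
    (forall x, x \in G -> c x != 0 -> exists s : 'cV_n, rG (x^-1)%g = 1%:M + s *m a) ->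
    \sum_(x in G) c x = 0 ->
  exists q, \sum_(x in G) c x *: act x p = q * linear_form a.
Proof.
move=> rank1 c0.
have : forall x, exists q, x \in G -> c x *: (act x p - p) = q * linear_form a.
  move=> x; case: (boolP (x \in G)) => [Gx|]; last by exists 0.
  have [->|cx] := eqVneq (c x) 0; first by exists 0; rewrite scale0r mul0r.
  have [s xE] := rank1 x Gx cx; have [q qP] := linear_form_dvd_act p xE.
  by exists (c x *: q); rewrite qP scalerAl.
case/fin_all_exists=> q qP; exists (\sum_(x in G) q x).
rewrite mulr_suml; under [RHS]eq_bigr => x Gx do rewrite -qP // scalerBr.
by rewrite sumrB -scaler_suml c0 scale0r subr0.
Qed.

Variables (I : eqType) (Hs : seq I) (a : I -> 'rV[F]_n) (c : I -> gT -> F).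
Variable D : I -> P -> P.
Hypothesis a_neq0 : forall H, H \in Hs -> a H != 0.
Hypothesis c_rank1 : forall H, H \in Hs -> forall x, x \in G -> c H x != 0 ->
  exists s : 'cV_n, rG (x^-1)%g = 1%:M + s *m a H.
Hypothesis c_sum : forall H, H \in Hs -> \sum_(x in G) c H x = 0.
Hypothesis D_spec : forall H, H \in Hs -> forall p,
  D H p * linear_form (a H) = \sum_(x in G) c H x *: act x p.

(** [D H p] is known only through its product with a nonzero linear form; identities about it are
    proved after multiplying by that form and cancelling. *)
Lemma D_linear H : H \in Hs -> linear (D H).
Proof.
move=> HH b p q; apply: (mulIf (linear_form_neq0 (a_neq0 HH))).
rewrite mulrDl -scalerAl !D_spec // scaler_sumr -big_split.
by apply: eq_bigr => x _; rewrite linearP scalerDr !scalerA mulrC.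
Qed.

(** The defect x . x_l - x_l equals s_l times the linear form. Division leaves s_l, and the factor
    [a H 0 i] completes it to the matrix entry (x^{-1} - 1)_{li}, so that the brackets for different
    H can be added. *)
Lemma D_mulX H i l p : H \in Hs -> a H 0 i *: D H ('X_l * p) =
  'X_l * (a H 0 i *: D H p) +
  \sum_(x in G) (c H x * (rG (x^-1)%g - 1%:M) l i) *: act x p.
Proof.
move=> HH; apply: (mulIf (linear_form_neq0 (a_neq0 HH))).
rewrite mulrDl -!scalerAr -!scalerAl -mulrA !D_spec // mulr_sumr !scaler_sumr mulr_suml.
rewrite -big_split; apply: eq_bigr => x Gx /=.
have [->|cx] := eqVneq (c H x) 0; first
  by rewrite mul0r !(scale0r, mulr0, mul0r, scaler0, addr0).
have [s xE] := c_rank1 HH Gx cx.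
have -> : act x ('X_l * p) = 'X_l * act x p + s l 0 *: (linear_form (a H) * act x p).
  rewrite lin_subst_mulX; set q := lin_subst _ p.
  rewrite xE /linear_form mulr_suml scaler_sumr.
  rewrite (eq_bigr (fun j => (l == j)%:R *: ('X_j * q) +
      s l 0 *: (a H 0 j *: 'X_j * q))) => [|j _].
    rewrite big_split /=; congr (_ + _); rewrite (bigD1 l) //= eqxx scale1r.
    by rewrite big1 ?addr0 // => j jl; rewrite eq_sym (negPf jl) scale0r.
  by rewrite !mxE big_ord1 scalerDl -scalerAl scalerA.
have -> : (rG (x^-1)%g - 1%:M) l i = s l 0 * a H 0 i.
  by rewrite xE addrC addrA addNr add0r mxE big_ord1.
rewrite -scalerAr !scalerDr !scalerA -scalerAl [in RHS]mulrC.
by congr (_ *: _ + _ *: _); [exact: mulrC|ring|exact: mulrC].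
Qed.

Lemma dunkl_operators_exist : exists T : 'I_n -> {linear P -> P},
  [/\ forall i p, T i p = p^`M(i) + \sum_(H <- Hs) a H 0 i *: D H p,
      forall i, T i 1 = 0
    & forall i l p, T i ('X_l * p) = 'X_l * T i p + ((i == l)%:R *: p +
        \sum_(x in G) ((\sum_(H <- Hs) c H x) * (rG (x^-1)%g - 1%:M) l i) *: act x p)].
Proof.
pose t i p := p^`M(i) + \sum_(H <- Hs) a H 0 i *: D H p.
have t_linear i : linear (t i).
  move=> b p q; rewrite /t linearP /= scalerDr -!addrA; congr (_ + _).
  rewrite addrCA; congr (_ + _); rewrite scaler_sumr -big_split /=.
  apply: eq_big_seq => H HH; rewrite D_linear // scalerDr !scalerA.
  by rewrite mulrC.
pose T i : {linear P -> P} :=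
  HB.pack (t i) (GRing.isLinear.Build F P P _ (t i) (t_linear i)).
exists T.
split=> [//|i|i l p] /=; rewrite /t.
- have -> : (1 : P)^`M(i) = 0 by rewrite -mpolyC1 mderivC.
  rewrite add0r big_seq big1 // => H HH.
  suff -> : D H 1 = 0 by rewrite scaler0.
  apply: (mulIf (linear_form_neq0 (a_neq0 HH))); rewrite D_spec // mul0r.
  under eq_bigr => x _ do rewrite -mpolyC1 lin_substC.
  by rewrite -scaler_suml c_sum // scale0r.
rewrite mderiv_mulX mulrDr -!addrA; congr (_ + _); rewrite addrCA; congr (_ + _).
rewrite mulr_sumr.
under [X in _ = _ + X]eq_bigr => x _ do rewrite mulr_suml scaler_suml.
rewrite exchange_big -big_split; apply: eq_big_seq => H HH /=.
exact: D_mulX.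
Qed.

End QuotientOperators.

(** * The Dunkl complex *)

(** In a finite group every element is a product of generators, so the rank-one extensions of the
    generators compose to extensions for all of G. *)
Lemma exterior_map_exists (F : numFieldType) (n : nat) (P : lmodType F)
    (gT : finGroupType) (G : {group gT}) (rG : mx_representation F G n)
    (S : {set gT}) :
    S \subset G -> <<S>>%g = G ->
    (forall x, x \in S -> exists (s : 'cV_n) (a : 'rV_n), rG (x^-1)%g = 1%:M + s *m a) ->
  forall x, x \in G ->
  exists L : {linear {ffun {set 'I_n} -> P} -> {ffun {set 'I_n} -> P}},
    exterior_map (rG (x^-1)%g) L.
Proof.
move=> /subsetP sSG genS rank1S x Gx.
have /gen_prodgP[k [c cS ->]] : x \in <<S>>%g by rewrite genS.
pose Q y := y \in G /\
  exists L : {linear {ffun {set 'I_n} -> P} -> {ffun {set 'I_n} -> P}},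
    exterior_map (rG (y^-1)%g) L.
suff : Q (\prod_(i < k) c i)%g by case.
apply: (big_ind Q) => [|y1 y2 [Gy1 [L1 L1P]] [Gy2 [L2 L2P]]|i _].
- split; first exact: group1.
  by exists idfun; rewrite invg1 repr_mx1; apply: exterior_map_id.
- split; first exact: groupM.
  exists (L1 \o L2); rewrite invMg repr_mxM ?groupV //.
  exact: exterior_map_comp.
split; first exact/sSG.
have [s [a ->]] := rank1S _ (cS i).
by exists (rank1_map s a); apply: exterior_map_rank1.
Qed.

Definition mulX (n : nat) (F : comNzRingType) (i : 'I_n) (p : {mpoly F[n]}) :
    {mpoly F[n]} :=
  'X_i * p.

Fact mulX_is_linear (n : nat) (F : comNzRingType) (i : 'I_n) :
  linear (@mulX n F i).
Proof. by move=> c p q; rewrite /mulX mulrDr -scalerAr. Qed.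
HB.instance Definition _ (n : nat) (F : comNzRingType) (i : 'I_n) :=
  GRing.isLinear.Build F {mpoly F[n]} {mpoly F[n]} _ (@mulX n F i) (mulX_is_linear i).

Section DunklComplex.

Variables (F : numFieldType) (n : nat) (gT : finGroupType) (G : {group gT}).
Variable rG : mx_representation F G n.
Local Notation P := {mpoly F[n]}.
Local Notation W := {ffun {set 'I_n} -> {mpoly F[n]}}.
Local Notation act x := (lin_subst (rG (x^-1)%g)).
Implicit Types (x y : gT) (p : P) (i j l : 'I_n) (w : W).

Variables (z : gT -> F) (T : 'I_n -> {linear P -> P}).
Hypothesis zJ : {in G &, forall x y, z (x ^ y)%g = z x}.
Hypothesis z_sum : \sum_(x in G) z x = 0.
Hypothesis z_rank1 : forall x, x \in G -> z x != 0 ->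
  exists (u s : 'cV[F]_n) (a : 'rV[F]_n),
    rG x = 1%:M + u *m a /\ rG (x^-1)%g = 1%:M + s *m a.
Hypothesis T_1 : forall i, T i 1 = 0.
Hypothesis T_mulX : forall i l p, T i ('X_l * p) = 'X_l * T i p +
  ((i == l)%:R *: p + \sum_(x in G) (z x * (rG (x^-1)%g - 1%:M) l i) *: act x p).

Definition dT w : W := \sum_i ext i (coefwise (T i) w).

Fact dT_is_linear : linear dT.
Proof.
move=> c u v; rewrite /dT scaler_sumr -big_split; apply: eq_bigr => i _ /=.
by rewrite !linearP.
Qed.
HB.instance Definition _ := GRing.isLinear.Build F W W _ dT dT_is_linear.

Definition koszul w : W := \sum_i contr i (coefwise (mulX i) w).

Lemma dT_sq w : dT (dT w) = 0.
Proof.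
have dE : dT (dT w) = \sum_i \sum_j ext i (ext j (coefwise (T i) (coefwise (T j) w))).
  apply: eq_bigr => i _; rewrite !linear_sum; apply: eq_bigr => j _ /=.
  by rewrite coefwise_ext.
have : dT (dT w) = - dT (dT w).
  rewrite {1}dE exchange_big dE -sumrN; apply: eq_bigr => i _.
  rewrite -sumrN; apply: eq_bigr => j _ /=; rewrite extC; congr (- ext _ (ext _ _)).
  by apply/ffunP=> I; rewrite !ffunE (T_comm zJ z_rank1 T_1 T_mulX).
move/eqP; rewrite -addr_eq0 -mulr2n -scaler_nat scaler_eq0 Num.Theory.pnatr_eq0 /=.
by move/eqP.
Qed.

Lemma dT_pihomog m w :
  dT (coefwise (pihomog mdeg m.+1) w) = coefwise (pihomog mdeg m) (dT w).
Proof.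
rewrite linear_sum; apply: eq_bigr => i _ /=; rewrite coefwise_ext; congr (ext i _).
by apply/ffunP=> I; rewrite !ffunE (T_pihomog T_1 T_mulX).
Qed.

Lemma dT_pihomog0 w : dT (coefwise (pihomog mdeg 0) w) = 0.
Proof.
rewrite /dT big1 // => i _.
suff -> : coefwise (T i) (coefwise (pihomog mdeg 0) w) = 0 by rewrite linear0.
by apply/ffunP=> I; rewrite !ffunE (T_pihomog0 T_1).
Qed.

Lemma proj_dT k w : proj k.+1 (dT w) = dT (proj k w).
Proof.
rewrite linear_sum; apply: eq_bigr => i _ /=; rewrite proj_ext; congr (ext i _).
by apply/ffunP=> I; rewrite !ffunE; case: ifP; rewrite // linear0.
Qed.

(** * The diagonal action and the contracting homotopy *)

Section DiagonalAction.

(* By [exterior_map_unique], any choice of [Lam] is a representation of [G]. *)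
Variable Lam : gT -> {linear W -> W}.
Hypothesis LamP : forall x, x \in G -> exterior_map (rG (x^-1)%g) (Lam x).

Definition diag_act x : {linear W -> W} := coefwise (act x) \o Lam x.

Lemma diag_act1 : diag_act 1%g =1 id.
Proof.
move=> w; rewrite /diag_act /=.
have -> : Lam 1%g w = w.
  apply: (exterior_map_unique (L2 := idfun) (LamP (group1 G))).
  by rewrite invg1 repr_mx1; apply: exterior_map_id.
by apply/ffunP=> I; rewrite ffunE lin_subst_repr1.
Qed.

Lemma diag_actM :
  {in G &, forall x y w, diag_act (x * y)%g w = diag_act x (diag_act y w)}.
Proof.
move=> x y Gx Gy w; rewrite /diag_act /=.
have -> : Lam (x * y)%g w = Lam x (Lam y w).
  apply: (exterior_map_unique (L2 := Lam x \o Lam y) (LamP (groupM Gx Gy))).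
  by rewrite invMg repr_mxM ?groupV //; apply: exterior_map_comp; apply: LamP.
have [LamC _ _] := LamP Gx; rewrite LamC.
by apply/ffunP=> I; rewrite !ffunE lin_subst_reprM.
Qed.

(** The [T i] transform by the matrix of x and the dx_i by that of x^{-1}; the two contract to the
    identity, so the tensor sum_i dx_i T_i is invariant. *)
Lemma dT_diag_act x w : x \in G -> dT (diag_act x w) = diag_act x (dT w).
Proof.
move=> Gx; have [LamC LamE _] := LamP Gx.
have LT i : coefwise (act x) (coefwise (T i) (Lam x w)) =
    \sum_k rG x k i *: coefwise (T k) (coefwise (act x) (Lam x w)).
  apply/ffunP=> I; rewrite sum_ffunE !ffunE.
  rewrite (T_equivariant zJ T_1 T_mulX _ _ Gx).
  by apply: eq_bigr => k _; rewrite !ffunE.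
rewrite [dT w]/dT linear_sum /=.
transitivity (\sum_i \sum_j \sum_k (rG x k i * rG (x^-1)%g i j) *:
    ext j (coefwise (T k) (coefwise (act x) (Lam x w)))); last first.
  apply: eq_bigr => i _; rewrite LamE linear_sum; apply: eq_bigr => j _.
  rewrite linearZ /= coefwise_ext LamC LT linear_sum scaler_sumr.
  by apply: eq_bigr => k _; rewrite linearZ /= scalerA mulrC.
rewrite exchange_big; apply: eq_bigr => j _ /=; rewrite exchange_big /=.
have xK k : \sum_i rG x k i * rG (x^-1)%g i j = (k == j)%:R.
  have : (rG x *m rG (x^-1)%g) k j = (1%:M : 'M_n) k j.
    by rewrite -repr_mxM ?groupV // mulgV repr_mx1.
  by rewrite !mxE.
rewrite [RHS](eq_bigr (fun k => (k == j)%:R *: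
    ext j (coefwise (T k) (coefwise (act x) (Lam x w))))) => [|k _]; last first.
  by rewrite -xK scaler_suml.
rewrite (bigD1 j) //= eqxx scale1r big1 ?addr0 // => k kj.
by rewrite (negPf kj) scale0r.
Qed.

(** By anticommutation, d b + b d = sum_i x_i T_i + sum_{i,j} ext_i contr_j [T_i, x_j]. The first
    sum is m plus z on coefficients. In the second, the scalar part of the bracket counts the form
    degree k, and the group part corrects z to its diagonal action. *)
Lemma laplacian k m w : proj k w = w -> coefwise (pihomog mdeg m) w = w ->
  dT (koszul w) + koszul (dT w) =
  (k + m)%:R *: w + \sum_(x in G) z x *: diag_act x w.
Proof.
move=> wk wm.
have -> : dT (koszul w) =
    \sum_i \sum_j ext i (contr j (coefwise (T i) (coefwise (mulX j) w))).
  apply: eq_bigr => i _; rewrite !linear_sum; apply: eq_bigr => j _ /=.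
  by rewrite coefwise_contr.
have -> : koszul (dT w) = \sum_i (coefwise (mulX i) (coefwise (T i) w) -
    \sum_j ext i (contr j (coefwise (mulX j) (coefwise (T i) w)))).
  transitivity (\sum_j \sum_i contr j (ext i (coefwise (mulX j) (coefwise (T i) w)))).
    apply: eq_bigr => j _; rewrite !linear_sum; apply: eq_bigr => i _ /=.
    by rewrite coefwise_ext.
  rewrite exchange_big; apply: eq_bigr => i _ /=.
  rewrite (eq_bigr (fun j => (if i == j then coefwise (mulX j) (coefwise (T i) w) else 0) -
    ext i (contr j (coefwise (mulX j) (coefwise (T i) w))))) => [|j _]; last first.
    by rewrite contr_ext; case: eqP => [->|].
  rewrite sumrB; congr (_ - _); rewrite -big_mkcond /=.
  by rewrite (eq_bigl (pred1 i)) ?big_pred1_eq // => j; rewrite eq_sym.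
rewrite sumrB [X in _ + X]addrC addrA -sumrB.
have -> : \sum_i coefwise (mulX i) (coefwise (T i) w) =
    m%:R *: w + \sum_(x in G) z x *: coefwise (act x) w.
  apply/ffunP=> I; rewrite !ffunE !sum_ffunE.
  have : w I = pihomog mdeg m (w I) by rewrite -{1}wm ffunE.
  move/(sum_X_T z_sum T_1 T_mulX) => TE.
  transitivity (\sum_i 'X_i * T i (w I)).
    by apply: eq_bigr => i _; rewrite !ffunE.
  by rewrite TE; congr (_ + _); apply: eq_bigr => x _; rewrite !ffunE.
have comE i j :
    coefwise (T i) (coefwise (mulX j) w) - coefwise (mulX j) (coefwise (T i) w) =
    (if i == j then w else 0) +
    \sum_(x in G) (z x * (rG (x^-1)%g - 1%:M) j i) *: coefwise (act x) w.
  apply/ffunP=> I; rewrite !ffunE sum_ffunE /mulX T_mulX addrAC subrr add0r.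
  congr (_ + _); first by case: eqP; rewrite ?ffunE ?scale1r ?scale0r.
  by apply: eq_bigr => x _; rewrite !ffunE.
rewrite (eq_bigr (fun i => ext i (contr i w) + \sum_(x in G) z x *:
    \sum_j (rG (x^-1)%g - 1%:M) j i *: ext i (contr j (coefwise (act x) w))))
    => [|i _]; last first.
  rewrite -sumrB.
  under eq_bigr => j _ do rewrite -!linearB comE !linearD !linear_sum /=.
  rewrite big_split /=; congr (_ + _).
    rewrite (bigD1 i) //= eqxx big1 ?addr0 // => j ji.
    by rewrite eq_sym (negPf ji) !linear0.
  rewrite exchange_big; apply: eq_bigr => x _; rewrite scaler_sumr.
  by apply: eq_bigr => j _; rewrite [contr _ _]linearZ [LHS]linearZ scalerA.
rewrite big_split (sum_ext_contr wk) natrD scalerDl -!addrA; congr (_ + _).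
rewrite addrCA; congr (_ + _); rewrite exchange_big -big_split.
apply: eq_bigr => x Gx /=; have [->|zx] := eqVneq (z x) 0.
  by rewrite !scale0r addr0 big1 // => i _; rewrite scale0r.
have [_ [s [a [_ xE]]]] := z_rank1 Gx zx.
rewrite -scaler_sumr -scalerDr; congr (_ *: _); rewrite addrC.
have [LamC _ _] := LamP Gx; rewrite -LamC.
(* By uniqueness [Lam x] is the rank-one map, whose double sum is exactly the correction with
   coefficients (x^{-1} - 1)_{ji}. *)
have LamR := @exterior_map_rank1 F n P s a.
rewrite (exterior_map_unique (LamP Gx) (L2 := rank1_map s a)) ?xE //.
congr (_ + _); apply: eq_bigr => i _; apply: eq_bigr => j _.
by congr (_ *: _); rewrite [1%:M + _]addrC addrK mxE big_ord1 mulrC.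
Qed.

Hypothesis irrz : forall m (tau : mx_representation F G m) (c : F),
  mx_irreducible tau -> \sum_(x in G) z x *: tau x = c%:M ->
  forall j : nat, - c <> j.+1%:R.

(** The primitive is the inverse of k + m + z applied to [koszul w]. The second conclusion records
    that it vanishes with [koszul w], which yields injectivity on 0-forms. *)
Lemma exact_homogeneous k m w : (0 < k + m)%N ->
    proj k w = w -> coefwise (pihomog mdeg m) w = w -> dT w = 0 ->
  exists2 u, dT u = w & koszul w = 0 -> u = 0.
Proof.
move=> km wk wm dw.
have [|b bK] := @group_algebra_inverse F gT G z (k + m)%:R zJ.
  (* Positive integers are written [j.+1] in the hypothesis, hence the predecessor of k + m. *)
  move=> d tau irr_tau /(irrz irr_tau)/(_ (k + m).-1); apply.
  by rewrite opprK prednK.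
exists (\sum_(x in G) b x *: diag_act x (koszul w)) => [|->]; last first.
  by rewrite big1 // => x _; rewrite linear0 scaler0.
rewrite -[RHS](bK _ _ diag_act1 diag_actM) -(laplacian wk wm) dw.
have -> : koszul 0 = 0.
  rewrite /koszul big1 // => i _.
  suff -> : coefwise (mulX i) (0 : W) = 0 by rewrite linear0.
  exact: linear0.
rewrite addr0 linear_sum; apply: eq_bigr => x Gx.
by rewrite linearZ /= dT_diag_act.
Qed.

End DiagonalAction.

Lemma coefwise_pihomog_sum w : exists N, w = \sum_(m < N) coefwise (pihomog mdeg m) w.
Proof.
exists (\max_I msize (w I)); apply/ffunP=> I; rewrite sum_ffunE.
rewrite [LHS](@pihomog_partitionE _ _ mdeg (\max_I msize (w I))).
  by apply: eq_bigr => m _; rewrite ffunE.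
exact: (leq_bigmax (F := fun I => msize (w I))).
Qed.

Hypothesis Lam_exists : forall x, x \in G -> exists L : {linear W -> W},
  exterior_map (rG (x^-1)%g) L.
Hypothesis irrz : forall m (tau : mx_representation F G m) (c : F),
  mx_irreducible tau -> \sum_(x in G) z x *: tau x = c%:M ->
  forall j : nat, - c <> j.+1%:R.

Lemma exact_homogeneous_part k m w : (0 < k + m)%N ->
    proj k w = w -> dT w = 0 ->
  exists2 u, dT u = coefwise (pihomog mdeg m) w &
             koszul (coefwise (pihomog mdeg m) w) = 0 -> u = 0.
Proof.
move=> km wk dw.
have [Lam LamP] : exists Lam : gT -> {linear W -> W},
    forall x, x \in G -> exterior_map (rG (x^-1)%g) (Lam x).
  apply: (@fin_all_exists gT (fun=> {linear W -> W})
    (fun x L => x \in G -> exterior_map (rG (x^-1)%g) L)) => x.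
  case: (boolP (x \in G)) => [/Lam_exists[L LP]|_]; first by exists L.
  by exists idfun.
apply: (exact_homogeneous LamP irrz km).
- by apply/ffunP=> I; rewrite !ffunE -[in RHS]wk ffunE; case: ifP; rewrite // linear0.
- by apply/ffunP=> I; rewrite !ffunE pihomog_id.
by case: m {km} => [|m]; rewrite ?dT_pihomog0 // dT_pihomog dw linear0.
Qed.

Lemma dT_inj w : proj 0 w = w -> coefwise (pihomog mdeg 0) w = 0 -> dT w = 0 -> w = 0.
Proof.
move=> w0 ww dw; have [N ->] := coefwise_pihomog_sum w.
(* The component of degree 0 vanishes by hypothesis. In positive degree a 0-form is killed by
   [koszul], so its primitive is zero, and so is the component itself. *)
apply: big1 => -[[|m] mN] _ //=.
have [//|u uE u0] := @exact_homogeneous_part 0 m.+1 w _ w0 dw.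
rewrite -uE u0 ?linear0 //.
rewrite /koszul big1 // => i _; apply/ffunP=> I; rewrite !ffunE.
case: ifP => // iI; rewrite -w0 ffunE.
by rewrite (cardsD1 i) setU11 /= linear0 [mulX _ _]linear0 scaler0.
Qed.

Lemma dT_exact k w : proj k.+1 w = w -> dT w = 0 ->
  exists u, [/\ proj k u = u, k = 0%N -> coefwise (pihomog mdeg 0) u = 0 & dT u = w].
Proof.
move=> wk dw; have [N wE] := coefwise_pihomog_sum w.
have [f fP] : exists f : 'I_N -> W, forall m, dT (f m) = coefwise (pihomog mdeg m) w.
  apply: (@fin_all_exists _ (fun=> W)
    (fun (m : 'I_N) u => dT u = coefwise (pihomog mdeg m) w)) => m.
  by have [//|u uP _] := @exact_homogeneous_part k.+1 m w _ wk dw; exists u.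
(* The primitives come without a form degree. Projecting their sum loses nothing, since [dT] raises
   the form degree by exactly one. *)
pose v := proj k (\sum_(m < N) f m).
have dv : dT v = w.
  rewrite -proj_dT -[RHS]wk [in RHS]wE; congr (proj _ _).
  by rewrite [LHS](linear_sum dT); apply: eq_bigr => m _; apply: fP.
have vk : proj k v = v by apply/ffunP=> I; rewrite !ffunE; case: eqP.
(* For k = 0 the constant term has to leave, as K(+) omits it; [dT] kills it. *)
exists (v - (if k == 0%N then coefwise (pihomog mdeg 0) v else 0)); split.
- rewrite linearB /= vk; congr (_ - _); case: (k == 0%N); last exact: linear0.
  by apply/ffunP=> I; rewrite !ffunE; case: eqP => _; rewrite ?linear0.
- move=> ->; rewrite linearB /=; apply/ffunP=> I; rewrite !ffunE pihomog_id.
  by rewrite subrr.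
by rewrite linearB /= dv; case: ifP; rewrite ?dT_pihomog0 !linear0 addr0.
Qed.

End DunklComplex.

(** * Reflection hyperplanes *)

(* Both sides are the determinant of the block matrix [1, - a; u, 1]. *)
Lemma det_rank1 (F : comNzRingType) (n : nat) (u : 'cV[F]_n) (a : 'rV[F]_n) :
  \det (1%:M + u *m a) = 1 + (a *m u) 0 0.
Proof.
have e : block_mx 1%:M 0 u 1%:M *m block_mx 1%:M (- a) 0 (1%:M + u *m a) =
         block_mx (1%:M + a *m u) (- a) 0 1%:M *m block_mx (1%:M : 'M_1) 0 u 1%:M.
  rewrite !mulmx_block !mul1mx !mulmx1 !mul0mx !mulmx0 !addr0 !add0r.
  by rewrite mulmxN mulNmx addrK addrCA addNr addr0.
have := congr1 determinant e.
rewrite !det_mulmx !det_lblock !det_ublock !det1 !mul1r !mulr1 => ->.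
by rewrite det_mx11 !mxE.
Qed.

Section Hyperplanes.

Variables (R : realType) (n : nat) (gT : finGroupType) (G : {group gT}).
Variable rG : mx_representation R[i] G n.
Local Notation C := R[i].
Local Notation V := 'cV[C]_n.
Local Notation gact := Defs.gact.

Lemma gactE x v : gact rG x v = rG x *m v.
Proof. by rewrite lfunE. Qed.

Lemma gact_repr1 v : gact rG 1%g v = v.
Proof. by rewrite gactE repr_mx1 mul1mx. Qed.

Lemma gact_reprM x y v : x \in G -> y \in G ->
  gact rG (x * y)%g v = gact rG x (gact rG y v).
Proof. by move=> Gx Gy; rewrite !gactE repr_mxM // mulmxA. Qed.

Lemma gactK x : x \in G -> cancel (gact rG x) (gact rG x^-1%g).
Proof. by move=> Gx v; rewrite -gact_reprM ?groupV // mulVg gact_repr1. Qed.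

Lemma gactVK x : x \in G -> cancel (gact rG x^-1%g) (gact rG x).
Proof. by move=> Gx v; rewrite -gact_reprM ?groupV // mulgV gact_repr1. Qed.

Lemma hstabP (H : {vspace V}) x :
  reflect (x \in G /\ forall v, v \in H -> gact rG x v = v) (x \in hstab rG H).
Proof.
rewrite inE; apply: (iffP andP) => -[Gx Hx]; split=> //.
  by move=> v vH; apply/fixedSpaceP; apply: (subvP Hx).
by apply/subvP=> v vH; apply/fixedSpaceP; apply: Hx.
Qed.

Fact hstab_group_set (H : {vspace V}) : group_set (hstab rG H).
Proof.
apply/group_setP; split; first by apply/hstabP; split=> // v _; rewrite gact_repr1.
move=> x y /hstabP[Gx Hx] /hstabP[Gy Hy]; apply/hstabP; split; first exact: groupM.
by move=> v vH; rewrite gact_reprM // Hy // Hx.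
Qed.
Canonical hstab_group (H : {vspace V}) := Group (hstab_group_set H).

Definition form_row (f : 'Hom(V, C^o)) : 'rV[C]_n := \row_i f (delta_mx i 0).

Lemma form_rowE (f : 'Hom(V, C^o)) v : f v = (form_row f *m v) 0 0.
Proof.
rewrite mxE {1}(matrix_sum_delta v) linear_sum; apply: eq_bigr => i _.
by rewrite big_ord1 linearZ /= mxE mulrC.
Qed.

Lemma form_row_neq0 (H : {vspace V}) (f : 'Hom(V, C^o)) :
  hyperplane H -> lker f = H -> form_row f != 0.
Proof.
move=> /eqP dimH fH; apply/eqP=> f0.
have dimV : \dim {:V} = n by rewrite dimvf dim_matrix mulr1.
have : (\dim {:V} <= \dim H)%N.
  by apply: dimvS; rewrite -fH; apply/subvP=> v _; rewrite memv_ker form_rowE f0 mul0mx mxE.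
by move=> le; have := leq_ltn_trans le (ltnSn _); rewrite dimH dimV ltnn.
Qed.

(* with [f v = 1], every [w] differs from [f w *: v] by a vector of [H] *)
Lemma hstab_rank1 (H : {vspace V}) (f : 'Hom(V, C^o)) :
    hyperplane H -> lker f = H -> forall x, x \in hstab rG H ->
  exists u : 'cV[C]_n, rG x = 1%:M + u *m form_row f.
Proof.
move=> hH fH x /hstabP[Gx Hx].
have /rV0Pn[i fi] := form_row_neq0 hH fH.
pose v : V := (form_row f 0 i)^-1 *: delta_mx i 0.
have fv : f v = 1 by rewrite linearZ; move: fi; rewrite mxE; apply: mulVf.
have xE j : rG x *m delta_mx j 0 =
    delta_mx j 0 + f (delta_mx j 0) *: (rG x *m v - v).
  have : gact rG x (delta_mx j 0 - f (delta_mx j 0) *: v) =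
      delta_mx j 0 - f (delta_mx j 0) *: v.
    by apply: Hx; rewrite -fH memv_ker linearB linearZ /= fv [_ *: _]mulr1 subrr.
  rewrite gactE mulmxBr -scalemxAr => /(canRL (subrK _)) ->.
  by rewrite -addrA [- _ + _]addrC -scalerBr.
exists (rG x *m v - v); move: (rG x *m v - v) xE => u xE; apply/matrixP=> k j.
have := xE j; rewrite -colE => /colP/(_ k).
by rewrite !mxE big_ord1 eqxx andbT mulrC => ->; rewrite mxE.
Qed.

(** If the determinants agree, h = x y^{-1} has determinant 1, so h = 1 + u a with a u = 0: a
    transvection. Its powers are 1 + m u a, and in characteristic zero finite order forces u a =
    0. *)
Lemma det_hstab_inj (H : {vspace V}) (f : 'Hom(V, C^o)) :
    mx_faithful rG -> hyperplane H -> lker f = H ->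
  {in hstab rG H &, injective (fun x => \det (rG x))}.
Proof.
move=> rGf hH fH x y Hx Hy dxy.
have [[Gx _] [Gy _]] := (hstabP _ _ Hx, hstabP _ _ Hy).
have dy : \det (rG y) * \det (rG y^-1%g) = 1.
  by rewrite -det_mulmx -repr_mxM ?groupV // mulgV repr_mx1 det1.
pose h := (x * y^-1)%g; have Hh : h \in hstab rG H by rewrite groupM ?groupV.
have [Gh _] := hstabP _ _ Hh.
have [u hE] := hstab_rank1 hH fH Hh; set a := form_row f in hE.
have au : a *m u = 0.
  apply/rowP=> i; rewrite ord1 [RHS]mxE; apply: (addrI 1).
  by rewrite -det_rank1 -hE repr_mxM ?groupV // det_mulmx dxy dy addr0.
have hX m : rG (h ^+ m)%g = 1%:M + m%:R *: (u *m a).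
  elim: m => [|m IHm]; first by rewrite expg0 repr_mx1 scale0r addr0.
  rewrite expgSr repr_mxM ?groupX // IHm hE mulmxDl mul1mx mulmxDr mulmx1.
  rewrite -scalemxAl mulmxA -[u *m a *m u]mulmxA au mulmx0 mul0mx scaler0 addr0.
  by rewrite -addrA -[m.+1]addn1 natrD scalerDl scale1r [u *m a + _]addrC.
have ua : u *m a = 0.
  have := hX #[h]%g; rewrite expg_order repr_mx1 -[LHS]addr0 => /addrI/esym/eqP.
  by rewrite scaler_eq0 Num.Theory.pnatr_eq0 eqn0Ngt order_gt0 /= => /eqP.
have /(mx_faithful_inj rGf Gh (group1 G)) : rG h = rG 1%g.
  by rewrite hE ua addr0 repr_mx1.
by move/eqP; rewrite -eq_mulgV1 => /eqP.
Qed.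

(** Were det^i trivial on the stabilizer, injectivity of det would give e_H distinct i-th roots of
    unity with i < e_H. So some det^i(x0) differs from 1, and translating the sum by x0 multiplies
    it by that value. *)
Lemma sum_det_hstab (H : {vspace V}) (f : 'Hom(V, C^o)) i :
    mx_faithful rG -> hyperplane H -> lker f = H -> (0 < i < hord rG H)%N ->
  \sum_(x in hstab rG H) \det (rG x) ^+ i = 0.
Proof.
move=> rGf hH fH /andP[i0 ie].
have [x0 Hx0 dx0] : exists2 x, x \in hstab rG H & \det (rG x) ^+ i != 1.
  apply/exists_inP; apply: contraLR ie; rewrite negb_exists_in -leqNgt => /forall_inP di.
  have := @max_unity_roots _ i [seq \det (rG x) | x <- enum (hstab rG H)] i0.
  rewrite size_map -cardE; apply.
    apply/allP=> _ /mapP[x xH ->]; rewrite mem_enum in xH.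
    by apply/unity_rootP/eqP; have := di x xH; rewrite negbK.
  rewrite map_inj_in_uniq ?enum_uniq // => x y; rewrite !mem_enum.
  exact: (det_hstab_inj rGf hH fH).
have [Gx0 _] := hstabP _ _ Hx0.
set S := \sum_(x in _) _; apply/eqP.
have : S * (\det (rG x0) ^+ i - 1) = 0.
  rewrite mulrBr mulr1; apply/eqP; rewrite subr_eq0; apply/eqP.
  rewrite [RHS](reindex_inj (mulIg x0)) mulr_suml.
  apply: eq_big => x; first by rewrite groupMr.
  by move=> /hstabP[Gx _]; rewrite repr_mxM // det_mulmx exprMn.
by move/eqP; rewrite mulf_eq0 subr_eq0 (negPf dx0) orbF.
Qed.

Variable k : {fset {vspace V}} -> nat -> C.

(** The sum over i starts at 1, so a_H involves only nontrivial characters of the stabilizer and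
    acts by zero on constants. *)
Lemma sum_ha (H : {vspace V}) (f : 'Hom(V, C^o)) :
    mx_faithful rG -> hyperplane H -> lker f = H ->
  \sum_(x in G) ha rG k H x = 0.
Proof.
move=> rGf hH fH; rewrite /ha.
under eq_bigr => x _ do rewrite sum_ffunE.
rewrite exchange_big big_nat big1 //= => i iH.
under eq_bigr => x _ do rewrite !ffunE.
rewrite -scaler_sumr -big_mkcondr /=.
rewrite (eq_bigl (mem (hstab rG H))) => [|x]; last first.
  by rewrite andb_idl // => /hstabP[].
by rewrite -mulr_suml (sum_det_hstab rGf hH fH iH) mul0r scaler0.
Qed.

Lemma ha_neq0 (H : {vspace V}) x : ha rG k H x != 0 -> x \in hstab rG H.
Proof.
apply: contraNT => xH; rewrite sum_ffunE big1 // => i _.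
by rewrite !ffunE (negPf xH) scaler0.
Qed.

Definition himg y (H : {vspace V}) : {vspace V} := (gact rG y @: H)%VS.

Lemma himgM x y H : x \in G -> y \in G -> himg (x * y)%g H = himg x (himg y H).
Proof.
move=> Gx Gy; rewrite /himg -limg_comp; congr (_ @: _)%VS.
by apply/lfunP=> v; rewrite comp_lfunE gact_reprM.
Qed.

Lemma himg1 H : himg 1%g H = H.
Proof.
rewrite /himg [gact _ _](_ : _ = \1%VF) ?lim1g //.
by apply/lfunP=> v; rewrite gact_repr1 id_lfunE.
Qed.

Lemma dim_himg y H : y \in G -> \dim (himg y H) = \dim H.
Proof.
move=> Gy; apply: limg_dim_eq; suff -> : lker (gact rG y) = 0%VS by rewrite capv0.
by apply/eqP/lker0P; apply: can_inj (gactK Gy).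
Qed.

(** The inverse matches the convention x ^ y = y^{-1} x y: conjugating by y moves the fixed points
    by y^{-1}. *)
Lemma hstab_himg y H : y \in G -> hstab rG (himg y^-1%g H) = (hstab rG H :^ y)%g.
Proof.
move=> Gy; apply/setP=> x; rewrite mem_conjg.
have GV : y^-1%g \in G by rewrite groupV.
have Gx0 : (x \in G) = ((x ^ y^-1)%g \in G) by rewrite groupJr.
have : x = (y^-1 * ((x ^ y^-1) * y))%g by rewrite conjgE invgK !mulgA mulVg mul1g mulgKV.
move: (x ^ y^-1)%g Gx0 => c Gxc xE.
apply/hstabP/hstabP; rewrite -Gxc => -[Gx Hx]; split=> //.
  have Gc : c \in G by rewrite -Gxc.
  move=> v vH; have := Hx _ (memv_img (gact rG y^-1%g) vH).
  rewrite xE !gact_reprM ?groupM // gactVK // => /(congr1 (gact rG y)).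
  by rewrite !gactVK.
have Gc : c \in G by rewrite -Gxc.
move=> _ /memv_imgP[v vH ->].
by rewrite xE !gact_reprM ?groupM // gactVK // Hx.
Qed.

Lemma hord_himg y H : y \in G -> hord rG (himg y^-1%g H) = hord rG H.
Proof. by move=> Gy; rewrite /hord hstab_himg // cardJg. Qed.

Lemma horbit_himg y H : y \in G -> horbit rG (himg y H) = horbit rG H.
Proof.
move=> Gy; apply/fsetP=> U; apply/imfsetP/imfsetP=> /= -[x]; rewrite mem_enum => Gx ->.
  by exists (x * y)%g; [rewrite mem_enum groupM | rewrite -[RHS]/(himg (x * y)%g H) himgM].
exists (x * y^-1)%g; first by rewrite mem_enum groupM ?groupV.
rewrite -[LHS]/(himg x H) -[RHS]/(himg (x * y^-1)%g (himg y H)).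
by rewrite -himgM ?groupM ?groupV // mulgKV.
Qed.

Lemma heps_himg y H i x : x \in G -> y \in G ->
  heps rG (himg y^-1%g H) i (x ^ y)%g = heps rG H i x.
Proof.
move=> Gx Gy; have dE : \det (rG (x ^ y)%g) = \det (rG x).
  rewrite conjgE !repr_mxM ?groupM ?groupV // !det_mulmx mulrC -mulrA -det_mulmx.
  by rewrite -repr_mxM ?groupV // mulgV repr_mx1 det1 mulr1.
have hE := hord_himg H Gy; have sE := hstab_himg H Gy.
by rewrite /heps !ffunE hE sE memJ_conjg dE.
Qed.

(** Everything in a_H is invariant under transport by y: the order of the stabilizer, the
    determinants, and the parameters, which depend only on the orbit of H. As y permutes the
    hyperplanes, the sum z is a class function. *)
Lemma ha_himg y H x : x \in G -> y \in G ->
  ha rG k (himg y^-1%g H) (x ^ y)%g = ha rG k H x.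
Proof.
move=> Gx Gy; have GVy : y^-1%g \in G by rewrite groupV.
have hE := hord_himg H Gy; have oE := horbit_himg H GVy.
rewrite /ha hE oE [LHS]sum_ffunE [RHS]sum_ffunE.
apply: eq_bigr => i _; rewrite [LHS]ffunE [RHS]ffunE.
by rewrite heps_himg.
Qed.

Lemma hyperplanes_himg y H : mx_faithful rG -> y \in G ->
  (himg y^-1%g H \in hyperplanes rG) = (H \in hyperplanes rG).
Proof.
move=> rGf Gy; rewrite !in_hyperplanes // /reflection_hyperplane /hyperplane.
rewrite dim_himg ?groupV // hstab_himg //; congr (_ && ~~ _).
by rewrite -[1%g in LHS](conjs1g y) (inj_eq (@conjsg_inj _ y)).
Qed.

Lemma gzJ : mx_faithful rG ->
  {in G &, forall x y, gz rG k (x ^ y)%g = gz rG k x}.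
Proof.
move=> rGf x y Gx Gy; rewrite /gz !sum_ffunE.
have himgK : cancel (himg y^-1%g) (himg y).
  by move=> H; rewrite -himgM ?groupV // mulgV himg1.
have himgVK : cancel (himg y) (himg y^-1%g).
  by move=> H; rewrite -himgM ?groupV // mulVg himg1.
rewrite (perm_big [seq himg y^-1%g H | H <- hyperplanes rG]) /=.
  by rewrite big_map; apply: eq_bigr => H _; rewrite ha_himg.
apply: uniq_perm; first exact: fset_uniq.
  by rewrite (map_inj_uniq (can_inj himgK)) fset_uniq.
move=> H; apply/idP/mapP=> [HH|[U UH ->]]; last by rewrite hyperplanes_himg.
exists (himg y H); last by rewrite himgVK.
by rewrite -(hyperplanes_himg _ rGf Gy) himgVK.
Qed.

End Hyperplanes.

Lemma mderiv_linear_form (n : nat) (F : comNzRingType) (a : 'rV[F]_n) (i : 'I_n) :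
  (linear_form a)^`M(i) = (a 0 i)%:MP.
Proof.
rewrite /linear_form linear_sum (bigD1 i) //= big1 => [|j ji].
  rewrite addr0 linearZ /= -['X_i]mulr1 mderiv_mulX -mpolyC1 mderivC mulr0 add0r.
  by rewrite eqxx scale1r mpolyC1 alg_mpolyC.
rewrite linearZ /= -['X_j]mulr1 mderiv_mulX -mpolyC1 mderivC mulr0 add0r.
by rewrite eq_sym (negPf ji) scale0r scaler0.
Qed.

(** * The differential [dunkl_d] expressed through Dunkl operators *)

Section DunklDifferential.

Variables (R : realType) (n : nat) (gT : finGroupType) (G : {group gT}).
Variable rG : mx_representation R[i] G n.
Local Notation C := R[i].
Local Notation V := 'cV[C]_n.
Local Notation P := {mpoly C[n]}.
Local Notation act x := (lin_subst (rG (x^-1)%g)).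
Hypothesis hG : complex_reflection_group rG.
Variable alpha : {vspace V} -> 'Hom(V, C^o).
Hypothesis halpha : forall H, H \in hyperplanes rG -> lker (alpha H) = H.
Variable k : {fset {vspace V}} -> nat -> C.

Let rGf : mx_faithful rG. Proof. by case: hG. Qed.
Local Notation Hs := (enum_fset (hyperplanes rG)).
Local Notation quo H p :=
  (poly_quo (galg_poly rG (ha rG k H) p) (linear_poly (alpha H))).

Lemma hyperplane_in H : H \in hyperplanes rG -> hyperplane H.
Proof. by rewrite in_hyperplanes // => /andP[]. Qed.

Lemma galg_polyE (b : {ffun gT -> C^o}) p :
  galg_poly rG b p = \sum_(x in G) b x *: act x p.
Proof. by rewrite /galg_poly lin_subst.unlock. Qed.

Lemma linear_polyE (f : 'Hom(V, C^o)) : linear_poly f = linear_form (form_row f).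
Proof. by apply: eq_bigr => i _; rewrite mxE. Qed.

Lemma hyperplane_form_neq0 H : H \in Hs -> form_row (alpha H) != 0.
Proof. by move=> HH; apply: form_row_neq0 (hyperplane_in HH) (halpha HH). Qed.

Lemma ha_rank1 H x : H \in Hs -> x \in hstab rG H ->
  exists s : 'cV_n, rG (x^-1)%g = 1%:M + s *m form_row (alpha H).
Proof.
by move=> HH Hx; apply: (hstab_rank1 (hyperplane_in HH) (halpha HH)); rewrite groupV.
Qed.

(** Divisibility holds for every p, so [poly_quo] returns a genuine quotient and never its default
    0. *)
Lemma quo_spec H p : H \in Hs ->
  quo H p * linear_form (form_row (alpha H)) = \sum_(x in G) ha rG k H x *: act x p.
Proof.
move=> HH; rewrite -galg_polyE -linear_polyE.
apply: (@classical_sets.xgetPex _ 0 (fun r => r * linear_poly (alpha H) = _)).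
rewrite linear_polyE galg_polyE.
have r1 x : x \in G -> ha rG k H x != 0 ->
    exists s : 'cV_n, rG (x^-1)%g = 1%:M + s *m form_row (alpha H).
  by move=> _ /ha_neq0; apply: ha_rank1.
have [q ->] := linear_form_dvd_sum p r1 (sum_ha k rGf (hyperplane_in HH) (halpha HH)).
by exists q.
Qed.

Lemma dunkl_oneform (T : 'I_n -> {linear P -> P}) (p : P) (J : {set 'I_n}) :
    (forall i, T i p = p^`M(i) + \sum_(H <- Hs) form_row (alpha H) 0 i *: quo H p) ->
  (pdiff p + \sum_(H <- hyperplanes rG) dunkl_term rG k alpha H p) J =
  \sum_i if J == [set i] then T i p else 0.
Proof.
move=> TE; rewrite ffunE !sum_ffunE.
transitivity (\sum_i (if J == [set i] then p^`M(i) else 0) +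
    \sum_(H <- Hs) \sum_i if J == [set i] then form_row (alpha H) 0 i *: quo H p else 0).
  congr (_ + _); first by apply: eq_bigr => i _; rewrite ffunE.
  apply: eq_bigr => H _; rewrite ffunE sum_ffunE mulr_sumr; apply: eq_bigr => i _.
  rewrite ffunE; case: ifP => _; last by rewrite mulr0.
  by rewrite linear_polyE mderiv_linear_form mulrC mul_mpolyC.
rewrite exchange_big -big_split; apply: eq_bigr => i _ /=; rewrite TE.
by case: ifP => _ //; rewrite big1 ?addr0.
Qed.

(** Only the singletons [set i] contribute to the wedge product of a 1-form with dx_I, and their
    inversion count is the exponent [nbelow i K] in [ext]. *)
Lemma dunkl_dE (T : 'I_n -> {linear P -> P}) (w : pform R n) :
    (forall i p, T i p = p^`M(i) + \sum_(H <- Hs) form_row (alpha H) 0 i *: quo H p) ->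
  dunkl_d rG k alpha w = dT T w.
Proof.
move=> TE; apply/ffunP=> K; rewrite !sum_ffunE.
transitivity (\sum_(J : {set 'I_n} | J \subset K) \sum_i
    (-1) ^+ winv J (K :\: J) * (if J == [set i] then T i (w (K :\: J)) else 0)).
  under eq_bigr => I _ do rewrite ffunE.
  rewrite exchange_big; apply: eq_bigr => J JK /=.
  rewrite (bigD1 (K :\: J) isT) /= [X in _ + X = _]big1; last first.
    by move=> I IJ; rewrite [form_tensor _ _ _]ffunE eq_sym (negPf IJ) !mulr0.
  rewrite addr0 [form_tensor _ _ _]ffunE eqxx mulr1.
  by rewrite (dunkl_oneform _ (fun i => TE i _)) mulr_sumr.
rewrite exchange_big; apply: eq_bigr => i _ /=; rewrite !ffunE.
case: ifP => iK; last first.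
  rewrite big1 // => J JK; case: eqP => [Ji|_]; last by rewrite mulr0.
  by move: JK; rewrite Ji sub1set iK.
have iKs : [set i] \subset K by rewrite sub1set.
rewrite (bigD1 [set i] iKs) /= eqxx [X in _ + X = _]big1; last first.
  by move=> J /andP[_ /negPf->]; rewrite mulr0.
rewrite addr0.
have -> : winv [set i] (K :\: [set i]) = nbelow i K.
  rewrite /winv /nbelow; pose f (j : 'I_n) := (i, j).
  have fI : injective f by move=> j j' [].
  rewrite -(card_imset _ fI); apply: eq_card => -[i' j].
  rewrite !inE /=; apply/idP/imsetP.
    by case/and3P=> /eqP-> /andP[_ jK] ji; exists j; rewrite // inE jK.
  case=> j'; rewrite inE => /andP[jK ji] [-> ->]; rewrite eqxx jK ji !andbT /=.
  by apply: contraTneq ji => ->; rewrite ltnn.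
by rewrite -[in LHS]signr_odd -[in RHS]signr_odd scaler_sign mulr_sign.
Qed.

Lemma reflection_rank1 x : x \in G -> complex_reflection rG x ->
  exists (s : 'cV_n) (a : 'rV_n), rG (x^-1)%g = 1%:M + s *m a.
Proof.
move=> Gx; rewrite /complex_reflection; set H := fixedSpace _ => hH.
have Hx : x \in hstab rG H by rewrite inE Gx subvv.
have HH : H \in hyperplanes rG.
  rewrite in_hyperplanes // /reflection_hyperplane hH /=.
  (* With a trivial stabilizer x would be 1, whose fixed space is all of V and not a hyperplane. *)
  apply/eqP=> h1; move: Hx hH; rewrite h1 inE /H => /eqP ->.
  have dimV : \dim {:V} = n by rewrite dimvf dim_matrix mulr1.
  suff -> : fixedSpace (Defs.gact rG 1%g) = fullv.
    by rewrite /hyperplane => /eqP e; have := ltnSn (\dim {:V}); rewrite {2}e dimV ltnn.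
  apply/eqP; rewrite eqEsubv subvf; apply/subvP=> v _.
  by apply/fixedSpaceP; rewrite gact_repr1.
by have [s sE] := ha_rank1 HH Hx; exists s, (form_row (alpha H)).
Qed.

Lemma dunkl_structure : exists T : 'I_n -> {linear P -> P},
  [/\ forall w : pform R n, dunkl_d rG k alpha w = dT T w,
      forall i, T i 1 = 0
    & forall i l p, T i ('X_l * p) = 'X_l * T i p + ((i == l)%:R *: p +
        \sum_(x in G) (gz rG k x * (rG (x^-1)%g - 1%:M) l i) *: act x p)].
Proof.
have r1 H : H \in Hs -> forall x, x \in G -> ha rG k H x != 0 ->
    exists s : 'cV_n, rG (x^-1)%g = 1%:M + s *m form_row (alpha H).
  by move=> HH x _ /ha_neq0; apply: ha_rank1.
have c0 H : H \in Hs -> \sum_(x in G) ha rG k H x = 0.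
  by move=> HH; apply: (sum_ha k rGf (hyperplane_in HH) (halpha HH)).
have [T [TE T1 TX]] := dunkl_operators_exist hyperplane_form_neq0 r1 c0
  (fun H HH p => quo_spec p HH).
exists T; split=> // [w|i l p]; first exact: dunkl_dE.
rewrite TX; congr (_ + (_ + _)); apply: eq_bigr => x _.
by rewrite /gz sum_ffunE.
Qed.

Lemma sum_gz : \sum_(x in G) gz rG k x = 0.
Proof.
under eq_bigr => x _ do rewrite sum_ffunE.
rewrite exchange_big big_seq big1 // => H HH.
exact: (sum_ha k rGf (hyperplane_in HH) (halpha HH)).
Qed.

Lemma gz_rank1 x : x \in G -> gz rG k x != 0 ->
  exists (u s : 'cV[C]_n) (a : 'rV[C]_n),
    rG x = 1%:M + u *m a /\ rG (x^-1)%g = 1%:M + s *m a.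
Proof.
move=> Gx zx.
have [H HH Hx] : exists2 H, H \in Hs & x \in hstab rG H.
  apply/hasP; apply: contraNT zx => /hasPn nHx; rewrite sum_ffunE big_seq big1 //.
  by move=> H /nHx; apply: contraNeq => /ha_neq0.
have [u uE] := hstab_rank1 (hyperplane_in HH) (halpha HH) Hx.
by have [s sE] := ha_rank1 HH Hx; exists u, s, (form_row (alpha H)).
Qed.

End DunklDifferential.

(** * Membership in K(+) in terms of projections *)

Section FormDegrees.

Variables (R : realType) (n : nat).
Implicit Types (l : nat) (w : pform R n).

(** A nonzero coefficient has a nonzero homogeneous component, which some [form_part] would
    detect. *)
Lemma in_Kplus_proj l w : in_Kplus l w -> proj l w = w.
Proof.
move=> wK; apply/ffunP=> I; rewrite ffunE; case: eqP => // Il.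
have -> : w I = \sum_(m < msize (w I)) pihomog mdeg m (w I).
  exact: pihomog_partitionE.
rewrite big1 // => m _; have [/ffunP/(_ I)|/wK[]//] := eqVneq (form_part #|I| m w) 0.
by rewrite !ffunE eqxx.
Qed.

Lemma in_Kplus0_pihomog w : in_Kplus 0 w -> coefwise (pihomog mdeg 0) w = 0.
Proof.
move=> wK; have [w0|/wK[]//] := eqVneq (form_part 0 0 w) 0.
apply/ffunP=> I; move/ffunP/(_ I): w0; rewrite !ffunE; case: eqP => // I0 _.
by rewrite -(in_Kplus_proj wK) ffunE; case: eqP => // _; rewrite linear0.
Qed.

Lemma proj_in_Kplus l w : proj l w = w ->
  (l = 0%N -> coefwise (pihomog mdeg 0) w = 0) -> in_Kplus l w.
Proof.
move=> wl w0 l' m wlm.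
have l'l : l' = l.
  apply: contraNeq wlm => l'l; apply/eqP/ffunP=> I; rewrite !ffunE.
  case: eqP => // Il'; rewrite -wl ffunE Il' (negPf l'l) linear0 //.
split=> //; rewrite lt0n; apply: contraNneq wlm => /eqP.
rewrite addn_eq0 l'l => /andP[/eqP l0 /eqP ->]; apply/eqP/ffunP=> I; rewrite !ffunE.
by have /ffunP/(_ I) := w0 l0; rewrite !ffunE => ->; rewrite if_same.
Qed.

End FormDegrees.

Theorem corollary2p10 (R : realType) (n : nat) (gT : finGroupType)
    (G : {group gT}) (rG : mx_representation R[i] G n)
    (hG : complex_reflection_group rG)
    (alpha : {vspace 'cV[R[i]]_n} -> 'Hom('cV[R[i]]_n, R[i]^o))
    (halpha : forall H, H \in hyperplanes rG -> lker (alpha H) = H)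
    (k : {fset {vspace 'cV[R[i]]_n}} -> nat -> R[i]) :
  (forall w : pform R n, dunkl_d rG k alpha (dunkl_d rG k alpha w) = 0) /\
  ((forall (m : nat) (tau : mx_representation R[i] G m) (c : R[i]),
      mx_irreducible tau -> galg_repr tau (gz rG k) = c%:M ->
      forall j : nat, - c <> j.+1%:R) ->
   Kplus_acyclic (dunkl_d rG k alpha)).
Proof.
have [T [dE T1 TX]] := dunkl_structure hG halpha k.
have [rGf _ genG] := hG.
have zJ := gzJ k rGf.
have zr := gz_rank1 hG halpha (k := k).
split=> [w|irrz]; first by rewrite !dE (dT_sq zJ zr T1 TX).
(* Generation by complex reflections enters here, to extend the action of every element of G to
   forms. *)
have LamE : forall x, x \in G ->
    exists L : {linear {ffun {set 'I_n} -> {mpoly R[i][n]}} ->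
      {ffun {set 'I_n} -> {mpoly R[i][n]}}}, exterior_map (rG (x^-1)%g) L.
  have sSG : [set x in G | complex_reflection rG x] \subset G.
    by apply/subsetP=> x; rewrite inE => /andP[].
  apply: (@exterior_map_exists _ _ _ _ _ rG _ sSG genG) => x.
  by rewrite inE => /andP[]; apply: (reflection_rank1 hG halpha).
split=> [w wK|l w wK]; rewrite dE => dw.
  apply: (dT_inj zJ (sum_gz hG halpha k) zr T1 TX LamE irrz _ _ dw).
    exact: in_Kplus_proj.
  exact: in_Kplus0_pihomog.
have [u [ul u0 du]] := dT_exact zJ (sum_gz hG halpha k) zr T1 TX LamE irrz
  (in_Kplus_proj wK) dw.
by exists u; [exact: proj_in_Kplus | rewrite dE].
Qed.
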